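(* Let $(u,u_t,n,v)\in C\left(\mathbb{R}^+,H^1(\mathbb{R})\times L^2(\mathbb{R})\times L^2(\mathbb{R})\times L^2(\mathbb{R})\right)$ be a solution of the Klein-Gordon-Zakharov system $$u_{tt}-u_{xx}+u=-nu,\qquad n_t+v_x=0,\qquad v_t+\left(n+|u|^2\right)_x=0,$$ with finite energy $E_{KG}<\infty$, such that $$\sup_{t\ge0}\|u(t)\|_{H^1(\mathbb{R})}\le\varepsilon$$ for some $0<\varepsilon\le1$. Then, for every $\delta>0$ and every $\mu\in C^1(\mathbb{R})$ satisfying $\mu(t)\gtrsim t\log(t)^{1+\delta}$, $$\lim_{t\to\infty}\left(\|u(t)\|_{H^1(|x|\sim\mu(t))}+\|u_t(t)\|_{L^2(|x|\sim\mu(t))}+\|n(t)\|_{L^2(|x|\sim\mu(t))}+\|v(t)\|_{L^2(|x|\sim\mu(t))}\right)=0 .$$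
   Context: Here $(t,x)\in\mathbb{R}^+\times\mathbb{R}$ with $\mathbb{R}^+=[0,\infty)$, and $u,n,v$ are real-valued. The flow of the system preserves the energy $$E_{KG}=\int_{\mathbb{R}}|u|^2+|u_x|^2+|u_t|^2+\tfrac12\left(|n|^2+|v|^2\right)+n|u|^2\,dx$$ and the momentum $P_{KG}=\int_{\mathbb{R}}u_tu_x\,dx-\tfrac12\int_{\mathbb{R}}vn\,dx$. Notation: $\mu(t)\gtrsim b(t)$ means that there is a constant $c>0$ with $\mu(t)\ge c\,b(t)$ for $t\ge2$. $\|\cdot\|_{X(|x|\sim\mu(t))}$ denotes the $X$-norm ($X=L^2$ or $H^1$) over the region $\{x\in\mathbb{R}: c_1\mu(t)\le|x|\le c_2\mu(t)\}$, where $0<c_1<c_2$ are arbitrary fixed constants (independent of $t$). *)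

(* Defs.v *)
From HB Require Import structures.
From mathcomp Require Import all_boot all_order all_algebra.
From mathcomp Require Import all_classical all_reals all_analysis.
Set Implicit Arguments.
Unset Strict Implicit.
Unset Printing Implicit Defensive.
Import Order.TTheory GRing.Theory Num.Theory.
Import numFieldNormedType.Exports.

Local Open Scope classical_set_scope.
Local Open Scope ring_scope.

(* Elements of L^2 and H^1 are given by representatives [R -> R]; nothing below
   depends on the representative chosen.  A curve in such a space is a map
   [R -> R -> R], time first, of which only the values at times t >= 0 matter. *)

Definition inL2 (R : realType) (f : R -> R) : Prop :=
  f \in Lfun (@lebesgue_measure R) 2%:E.

Definition L2norm (R : realType) (A : set R) (f : R -> R) : R :=
  fine 'N[@lebesgue_measure R]_2%:E[EFin \o (f \_ A)]%E.

(* phi \in C_c^\infty(R) *)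
Definition test_function (R : realType) (phi : R -> R) : Prop :=
  (forall (k : nat) (x : R), derivable (derive1n k phi) x 1) /\
  compact (closure [set x | phi x != 0]).

Definition pairing (R : realType) (f phi : R -> R) : R :=
  (\int[@lebesgue_measure R]_x (f x * phi x))%R.

Definition is_weak_derivative (R : realType) (f g : R -> R) : Prop :=
  forall phi : R -> R, test_function phi ->
    pairing f (derive1 phi) = - pairing g phi.

Definition inH1 (R : realType) (f : R -> R) : Prop :=
  inL2 f /\ exists g, inL2 g /\ is_weak_derivative f g.

(* Unique up to a null set when [inH1 f] *)
Definition weak_derivative (R : realType) (f : R -> R) : R -> R :=
  xget (cst 0) [set g | inL2 g /\ is_weak_derivative f g].

Definition H1norm (R : realType) (A : set R) (f : R -> R) : R :=
  Num.sqrt (L2norm A f ^+ 2 + L2norm A (weak_derivative f) ^+ 2).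

(* w \in C([0, +oo[, X), where X is the space [inX] normed by [normX] *)
Definition continuous_curve (R : realType) (inX : (R -> R) -> Prop)
    (normX : (R -> R) -> R) (w : R -> R -> R) : Prop :=
  (forall t : R, 0 <= t -> inX (w t)) /\
  (forall t0 : R, 0 <= t0 ->
     (fun t => normX (w t \- w t0)) @ within [set t : R | 0 <= t] (nbhs t0)
       --> 0).

(* d/dt w(t) = T(t) in the space of distributions D'(R), for all t > 0 *)
Definition dt_distr (R : realType) (w : R -> R -> R)
    (T : R -> (R -> R) -> R) : Prop :=
  forall phi : R -> R, test_function phi -> forall t : R, 0 < t ->
    is_derive t (1 : R) (fun s => pairing (w s) phi) (T t phi).

(* Distributional solutions, with [ut] the time derivative of [u].  Space
   derivatives are moved onto the test function.  As all the curves are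
   continuous in time, this is the same as requiring the equations in
   D'(]0, +oo[ x R). *)
Record KGZ_solution (R : realType) (u ut n v : R -> R -> R) : Prop := {
  KGZ_u_cont : continuous_curve (@inH1 R) (@H1norm R setT) u ;
  KGZ_ut_cont : continuous_curve (@inL2 R) (@L2norm R setT) ut ;
  KGZ_n_cont : continuous_curve (@inL2 R) (@L2norm R setT) n ;
  KGZ_v_cont : continuous_curve (@inL2 R) (@L2norm R setT) v ;
  KGZ_ut : dt_distr u (fun t phi => pairing (ut t) phi) ;
  (* u_tt = u_xx - u - n u *)
  KGZ_eq_u : dt_distr ut (fun t phi =>
    pairing (u t) (derive1n 2 phi) - pairing (u t) phi
      - pairing (n t \* u t) phi) ;
  (* n_t = - v_x *)
  KGZ_eq_n : dt_distr n (fun t phi => pairing (v t) (derive1 phi)) ;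
  (* v_t = - (n + u^2)_x *)
  KGZ_eq_v : dt_distr v (fun t phi =>
    pairing (fun x => n t x + u t x ^+ 2) (derive1 phi))
}.

Definition KGZ_energy (R : realType) (u ut n v : R -> R) : \bar R :=
  (\int[@lebesgue_measure R]_x
    (u x ^+ 2 + weak_derivative u x ^+ 2 + ut x ^+ 2
      + 2^-1 * (n x ^+ 2 + v x ^+ 2) + n x * u x ^+ 2)%R%:E)%E.

Definition C1 (R : realType) (f : R -> R) : Prop :=
  (forall t : R, derivable f t 1) /\ continuous (derive1 f).

Definition gtrsim (R : realType) (mu b : R -> R) : Prop :=
  exists2 c : R, 0 < c & forall t : R, 2 <= t -> c * b t <= mu t.

(* |x| ~ r *)
Definition annulus (R : realType) (c1 c2 r : R) : set R :=
  [set x | c1 * r <= `|x| <= c2 * r].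

(* Main.v *)
Require Import Defs.
From HB Require Import structures.
From mathcomp Require Import all_boot all_order all_algebra.
From mathcomp Require Import all_classical all_reals all_analysis.
From mathcomp Require Import measurable_realfun.
From mathcomp Require Import ring lra.
Set Implicit Arguments.
Unset Strict Implicit.
Unset Printing Implicit Defensive.
Import Order.TTheory GRing.Theory Num.Theory.
Import numFieldNormedType.Exports.

Local Open Scope classical_set_scope.
Local Open Scope ring_scope.

(* The energy density e = u_t^2 + u_x^2 + u^2 + (n^2 + v^2)/2 + n u^2 satisfies
   e_t + flux_x = 0 with |flux| <= e as soon as |u| <= 1, which follows from the
   smallness of u in H^1 by the Sobolev inequality; moreover e then controls all
   the quantities of the theorem.  Integrating against a cutoff at scale r, the
   energy is conserved and the energy in |x| >= 2r at time t exceeds the energy in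
   |x| >= r at time 0 by at most O(t/r).  With r of size mu(t), t/r tends to 0
   since mu grows faster than t.

   The energy identity has to be proved for weak solutions.  The quantities
   u_t -+ u_x and n +- v solve transport equations with speed +-1 and sources that
   are continuous in L^2, so in the corresponding moving frame they are
   differentiable in time with values in L^2, and their products can be
   differentiated.  The same argument for the translates of u yields the product
   rule for u^2, so no mollification is needed; only the density of the test
   functions in L^2 is. *)

(** * The space L2 *)

(** None of u_x, u_t, n, v need have a time derivative in L2, so the energy cannot be differentiated
    term by term. Grouping it by speed of propagation cures this: the pairing of two curves of the
    same speed is unchanged by a common shift, after which both are differentiable in L2. The curve
    u itself, and with it u^2, can be followed at either speed, because u_t + s u_x lies in L2 for
    every s; this is what allows the cubic term n u^2 to be split between the two acoustic waves. A
    spatial weak derivative is handled by the same lemma, as transport of a function constant in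
    time.

    The Sobolev inequality is needed with constant 1, so that an H1 norm at most 1 gives |u| <= 1
    exactly. This bound makes n u a curve in L2 and lets u^2 absorb the u^4 left over when squares
    are completed in the density.

    Conservation of the total energy supplies a bound valid at all times, hence a drift linear in t
    with a fixed constant. As the power 1 + delta of ln t is at least ln t for large t, the
    resulting error t / r is O(1 / ln t). *)

Section L2_basics.
Context {R : realType}.
Local Notation mu := (@lebesgue_measure R).
Implicit Types (f g h : R -> R) (a b c : R).

Definition inL1 f := mu.-integrable setT (EFin \o f).

Lemma inL1_meas f : inL1 f -> measurable_fun setT f.
Proof. by move=> /integrableP[/measurable_EFinP]. Qed.

Lemma inL1D f g : inL1 f -> inL1 g -> inL1 (fun x => f x + g x).
Proof.
move=> hf hg; have := integrableD measurableT hf hg.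
by apply: eq_integrable.
Qed.

Lemma inL1Z c f : inL1 f -> inL1 (fun x => c * f x).
Proof.
move=> hf; have := integrableZl measurableT c hf.
by apply: eq_integrable.
Qed.

Lemma inL1N f : inL1 f -> inL1 (fun x => - f x).
Proof.
by move=> /(inL1Z (-1)); apply: eq_integrable => // x _ /=; rewrite mulN1r.
Qed.

Lemma inL1B f g : inL1 f -> inL1 g -> inL1 (fun x => f x - g x).
Proof. by move=> hf hg; apply: inL1D => //; apply: inL1N. Qed.

Lemma inL1_le f g : measurable_fun setT f -> inL1 g ->
  (forall x, `|f x| <= g x) -> inL1 f.
Proof.
move=> mf hg fg; apply: (le_integrable measurableT _ _ hg).
  exact/measurable_EFinP.
by move=> x _ /=; rewrite lee_fin (le_trans (fg x)) ?ler_norm.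
Qed.

Lemma inL1_bddM f g M : measurable_fun setT g -> (forall x, `|g x| <= M) ->
  inL1 f -> inL1 (fun x => g x * f x).
Proof.
move=> mg gM hf.
apply: (@inL1_le _ (fun x => M * `|f x|)).
- by apply: measurable_funM => //; apply: inL1_meas.
- apply: inL1Z; have := integrable_abse hf; exact: eq_integrable.
- by move=> x; rewrite normrM ler_wpM2r.
Qed.

Lemma RintD f g : inL1 f -> inL1 g ->
  (\int[mu]_x (f x + g x) = \int[mu]_x f x + \int[mu]_x g x)%R.
Proof. by move=> hf hg; apply: RintegralD. Qed.

Lemma RintZ c f : inL1 f -> (\int[mu]_x (c * f x) = c * \int[mu]_x f x)%R.
Proof. by move=> hf; apply: RintegralZl. Qed.

Lemma RintB f g : inL1 f -> inL1 g ->
  (\int[mu]_x (f x - g x) = \int[mu]_x f x - \int[mu]_x g x)%R.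
Proof. by move=> hf hg; apply: RintegralB. Qed.

Lemma eq_Rint f g : (forall x, f x = g x) ->
  (\int[mu]_x f x = \int[mu]_x g x)%R.
Proof. by move=> fg; apply: eq_Rintegral => x _. Qed.

Lemma le_Rint f g : inL1 f -> inL1 g -> (forall x, f x <= g x) ->
  (\int[mu]_x f x <= \int[mu]_x g x)%R.
Proof. by move=> hf hg fg; apply: le_Rintegral. Qed.

Lemma ler_norm_Rint f g : inL1 f -> inL1 g -> (forall x, `|f x| <= g x) ->
  (`|\int[mu]_x f x| <= \int[mu]_x g x)%R.
Proof.
move=> hf hg fg; apply: (le_trans (le_normr_Rintegral measurableT hf)).
apply: le_Rint => //; have := integrable_abse hf; exact: eq_integrable.
Qed.

Lemma EFin_Rint f : inL1 f ->
  ((\int[mu]_x f x)%R%:E = \int[mu]_x (f x)%:E)%E.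
Proof. by move=> hf; rewrite fineK//; apply: integrable_fin_num. Qed.

Lemma ae_Rint f g : measurable_fun setT f -> measurable_fun setT g ->
  {ae mu, forall x, f x = g x} ->
  (\int[mu]_x f x = \int[mu]_x g x)%R.
Proof.
move=> mf mg fg; rewrite /Rintegral; congr fine.
apply: ae_eq_integral => //; try exact/measurable_EFinP.
by apply: (@filterS _ _ (ae_filter_ringOfSetsType mu)) fg => x -> _.
Qed.

Lemma inL1_ae f g : measurable_fun setT g -> inL1 f ->
  {ae mu, forall x, f x = g x} -> inL1 g.
Proof.
move=> mg hf fg; move/integrableP: (hf) => [mf ff].
apply/integrableP; split; first exact/measurable_EFinP.
rewrite (le_lt_trans _ ff)//.
have -> : (\int[mu]_x `|(EFin \o g) x| = \int[mu]_x `|(EFin \o f) x|)%E; last by [].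
apply: ae_eq_integral => //.
- by apply: measurableT_comp => //; exact/measurable_EFinP.
- by apply: measurableT_comp.
- by apply: (@filterS _ _ (ae_filter_ringOfSetsType mu)) fg => x /= -> _.
Qed.

Lemma inL2_meas f : inL2 f -> measurable_fun setT f.
Proof. by rewrite /inL2 => /sub_Lfun_mfun; rewrite inE. Qed.

Lemma inL2_sqr f : inL2 f -> inL1 (fun x => f x ^+ 2).
Proof. exact: Lfun2_integrable_sqr. Qed.

Lemma normE f : ('N[mu]_2%:E[EFin \o f] = (\int[mu]_x (f x ^+ 2)%:E) `^ 2^-1)%E.
Proof.
rewrite unlock /=; congr (_ `^ _)%E; apply: eq_integral => x _.
by rewrite /= powR_mulrn// real_normK// num_real.
Qed.

Lemma inL2I f : measurable_fun setT f -> inL1 (fun x => f x ^+ 2) -> inL2 f.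
Proof.
move=> mf f2; rewrite /inL2 inE; apply/andP; split; rewrite inE//=.
rewrite /finite_norm normE poweR_lty//.
by rewrite -EFin_Rint// ltry.
Qed.

Lemma inL2_inL1M f g : inL2 f -> inL2 g -> inL1 (fun x => f x * g x).
Proof. by move=> hf hg; have /Lfun1_integrable := Lfun2_mul_Lfun1 hf hg. Qed.

Lemma inL2D f g : inL2 f -> inL2 g -> inL2 (fun x => f x + g x).
Proof.
move=> hf hg; apply: inL2I.
  by apply: measurable_funD; apply: inL2_meas.
have := inL1D (inL1D (inL2_sqr hf) (inL2_sqr hg)) (inL1Z 2 (inL2_inL1M hf hg)).
by apply: eq_integrable => // x _ /=; congr EFin; ring.
Qed.

Lemma inL2Z c f : inL2 f -> inL2 (fun x => c * f x).
Proof.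
move=> hf; apply: inL2I.
  by apply: measurable_funM => //; apply: inL2_meas.
have := inL1Z (c ^+ 2) (inL2_sqr hf).
by apply: eq_integrable => // x _ /=; congr EFin; ring.
Qed.

Lemma inL2N f : inL2 f -> inL2 (fun x => - f x).
Proof.
by move=> /(inL2Z (-1)); congr (inL2 _); apply/funext => x; rewrite mulN1r.
Qed.

Lemma inL2B f g : inL2 f -> inL2 g -> inL2 (fun x => f x - g x).
Proof. by move=> hf /inL2N; apply: inL2D. Qed.

Lemma inL2_bddM f g M : measurable_fun setT g -> (forall x, `|g x| <= M) ->
  inL2 f -> inL2 (fun x => g x * f x).
Proof.
move=> mg gM hf; apply: inL2I.
  by apply: measurable_funM => //; apply: inL2_meas.
have := @inL1_bddM _ (fun x => g x ^+ 2) (M ^+ 2) _ _ (inL2_sqr hf).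
move=> H; have {}H := H (measurable_funX _ mg) _.
have /H : forall x, `|g x ^+ 2| <= M ^+ 2.
  by move=> x; rewrite normrX lerXn2r ?nnegrE//; apply: le_trans (gM x).
by apply: eq_integrable => // x _ /=; congr EFin; ring.
Qed.

Lemma inL2_ae f g : measurable_fun setT g -> inL2 f ->
  {ae mu, forall x, f x = g x} -> inL2 g.
Proof.
move=> mg hf fg; apply: inL2I => //; apply: inL1_ae (inL2_sqr hf) _.
  exact: measurable_funX.
by apply: (@filterS _ _ (ae_filter_ringOfSetsType mu)) fg => x /= ->.
Qed.

Lemma pairingC f g : pairing f g = pairing g f.
Proof. by apply: eq_Rint => x; rewrite mulrC. Qed.

Lemma pairingDl f g h : inL2 f -> inL2 g -> inL2 h ->
  pairing (fun x => f x + g x) h = pairing f h + pairing g h.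
Proof.
move=> hf hg hh; rewrite -RintD; try exact: inL2_inL1M.
by apply: eq_Rint => x; rewrite mulrDl.
Qed.

Lemma pairingZl c f g : inL2 f -> inL2 g ->
  pairing (fun x => c * f x) g = c * pairing f g.
Proof.
move=> hf hg; rewrite -RintZ; try exact: inL2_inL1M.
by apply: eq_Rint => x; rewrite mulrA.
Qed.

Lemma pairingBl f g h : inL2 f -> inL2 g -> inL2 h ->
  pairing (fun x => f x - g x) h = pairing f h - pairing g h.
Proof.
move=> hf hg hh; rewrite -RintB; try exact: inL2_inL1M.
by apply: eq_Rint => x; rewrite mulrBl.
Qed.

Lemma pairingNl f g : inL2 f -> inL2 g ->
  pairing (fun x => - f x) g = - pairing f g.
Proof.
move=> hf hg; rewrite -mulN1r -pairingZl//.
by congr pairing; apply/funext => x; rewrite mulN1r.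
Qed.

Lemma pairingDr f g h : inL2 f -> inL2 g -> inL2 h ->
  pairing h (fun x => f x + g x) = pairing h f + pairing h g.
Proof. by move=> *; rewrite pairingC pairingDl// !(pairingC h). Qed.

Lemma pairingBr f g h : inL2 f -> inL2 g -> inL2 h ->
  pairing h (fun x => f x - g x) = pairing h f - pairing h g.
Proof. by move=> *; rewrite pairingC pairingBl// !(pairingC h). Qed.

Lemma pairingZr c f g : inL2 f -> inL2 g ->
  pairing g (fun x => c * f x) = c * pairing g f.
Proof. by move=> *; rewrite pairingC pairingZl// !(pairingC g). Qed.

Lemma pairing_ge0 f : 0 <= pairing f f.
Proof. by apply: Rintegral_ge0 => x _; rewrite -expr2 sqr_ge0. Qed.

Lemma pairing_ae f f' g g' : measurable_fun setT f -> measurable_fun setT f' ->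
  measurable_fun setT g -> measurable_fun setT g' ->
  {ae mu, forall x, f x = f' x} -> {ae mu, forall x, g x = g' x} ->
  pairing f g = pairing f' g'.
Proof.
move=> mf mf' mg mg' ff' gg'; apply: ae_Rint; try exact: measurable_funM.
by apply: (@filterS2 _ _ (ae_filter_ringOfSetsType mu)) ff' gg' => x /= -> ->.
Qed.

Definition nrm f := Num.sqrt (pairing f f).

Lemma nrm_ge0 f : 0 <= nrm f. Proof. exact: sqrtr_ge0. Qed.
Hint Resolve nrm_ge0 : core.

Lemma nrm_sqr f : nrm f ^+ 2 = pairing f f.
Proof. by rewrite sqr_sqrtr// pairing_ge0. Qed.

Lemma L2normT f : L2norm setT f = nrm f.
Proof.
rewrite /L2norm patch_setT normE fine_poweR /nrm -powR12_sqrt ?pairing_ge0//.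
Qed.

Lemma pairing_CS f g : inL2 f -> inL2 g -> `|pairing f g| <= nrm f * nrm g.
Proof.
move=> hf hg.
have H t : 0 <= pairing f f + t * pairing f g *+ 2 + t ^+ 2 * pairing g g.
  have hg' := inL2Z t hg.
  have := pairing_ge0 (fun x => f x + t * g x).
  rewrite pairingDl ?pairingDr//; try exact: inL2D.
  rewrite !pairingZl ?pairingZr// !(pairingC g f) => /le_trans; apply.
  by rewrite le_eqVlt; apply/orP; left; apply/eqP; ring.
have D : pairing f g ^+ 2 <= pairing f f * pairing g g.
  have [c0|c1] := eqVneq (pairing g g) 0.
    (* The quadratic is affine here; at this point it would equal [- pairing f f - 2], which is
       negative. So [pairing f g] must vanish. *)
    rewrite c0 mulr0; have := H (- (1 + pairing f f) / pairing f g).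
    have := pairing_ge0 f; rewrite c0 !mulr0 !addr0.
    have [->|b0] := eqVneq (pairing f g) 0; first by rewrite expr0n.
    rewrite divfK// => a0; rewrite mulr2n; nra.
  have c0 : 0 < pairing g g by rewrite lt_neqAle eq_sym c1 pairing_ge0.
  (* The minimiser of the quadratic. *)
  have := H (- pairing f g / pairing g g).
  set a := pairing f f; set b := pairing f g; set c := pairing g g.
  have -> : a + - b / c * b *+ 2 + (- b / c) ^+ 2 * c = a - b ^+ 2 / c by field.
  by rewrite subr_ge0 ler_pdivrMr.
rewrite -sqrtrM ?pairing_ge0// -sqrtr_sqr ler_sqrt//.
by rewrite mulr_ge0 ?pairing_ge0.
Qed.

Lemma nrmD f g : inL2 f -> inL2 g -> nrm (fun x => f x + g x) <= nrm f + nrm g.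
Proof.
move=> hf hg; rewrite -(@ler_pXn2r _ 2)// ?nnegrE ?addr_ge0//.
rewrite sqrrD !nrm_sqr pairingDl ?pairingDr//; try exact: inL2D.
rewrite (pairingC g f); have := pairing_CS hf hg.
rewrite ler_norml => /andP[_]; lra.
Qed.

Lemma nrmZ c f : inL2 f -> nrm (fun x => c * f x) = `|c| * nrm f.
Proof.
move=> hf; rewrite /nrm pairingZl ?pairingZr//; last exact: inL2Z.
by rewrite mulrA -expr2 sqrtrM ?sqr_ge0// sqrtr_sqr.
Qed.

Lemma nrmN f : nrm (fun x => - f x) = nrm f.
Proof.
by rewrite /nrm; congr Num.sqrt; apply: eq_Rint => x; rewrite mulrNN.
Qed.

Lemma nrmB f g : inL2 f -> inL2 g -> nrm (fun x => f x - g x) <= nrm f + nrm g.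
Proof. by move=> hf hg; rewrite -(nrmN g) nrmD//; apply: inL2N. Qed.

Lemma nrm_subC f g : nrm (fun x => f x - g x) = nrm (fun x => g x - f x).
Proof.
by rewrite -nrmN; congr nrm; apply/funext => x; rewrite opprB.
Qed.

Lemma nrm_triangle g f h : inL2 f -> inL2 g -> inL2 h ->
  nrm (fun x => f x - h x) <= nrm (fun x => f x - g x) + nrm (fun x => g x - h x).
Proof.
move=> hf hg hh; apply: le_trans (nrmD (inL2B hf hg) (inL2B hg hh)).
by rewrite le_eqVlt; apply/orP; left; apply/eqP; congr nrm; apply/funext => x; ring.
Qed.

Lemma ler_nrm f g : measurable_fun setT f -> inL2 g ->
  (forall x, `|f x| <= `|g x|) -> inL2 f /\ nrm f <= nrm g.
Proof.
move=> mf hg fg.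
have E x : f x ^+ 2 <= g x ^+ 2 by rewrite -real_normK ?num_real// -[g x ^+ 2]real_normK ?num_real// lerXn2r ?nnegrE.
have hf : inL2 f.
  apply: inL2I => //; apply: inL1_le (inL2_sqr hg) _; first exact: measurable_funX.
  by move=> x; rewrite ger0_norm ?sqr_ge0.
split=> //; rewrite ler_sqrt ?pairing_ge0//.
by apply: le_Rint => [||x]; [exact: inL2_inL1M|exact: inL2_inL1M|rewrite -!expr2].
Qed.

Lemma nrm_bddM f g M : measurable_fun setT g -> (forall x, `|g x| <= M) ->
  inL2 f -> nrm (fun x => g x * f x) <= M * nrm f.
Proof.
move=> mg gM hf.
have M0 : 0 <= M by apply: le_trans (gM 0).
rewrite -[M in M * _]ger0_norm// -nrmZ//.
apply: (ler_nrm _ _ _).2; first by apply: measurable_funM => //; exact: inL2_meas.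
  exact: inL2Z.
by move=> x; rewrite !normrM ler_wpM2r// (le_trans (gM x)) ?ler_norm.
Qed.

Lemma nrm_ae f g : measurable_fun setT f -> measurable_fun setT g ->
  {ae mu, forall x, f x = g x} -> nrm f = nrm g.
Proof. by move=> mf mg fg; rewrite /nrm (pairing_ae mf mg mf mg). Qed.

End L2_basics.
#[global] Hint Resolve nrm_ge0 : core.

(** * Dominated convergence and translations in L2 *)

Section limits_and_translations.
Context {R : realType}.
Local Notation mu := (@lebesgue_measure R).
Implicit Types (f g h : R -> R) (a b c : R).

Lemma Rint_cvg (F : nat -> R -> R) f g :
  (forall n, measurable_fun setT (F n)) -> measurable_fun setT f ->
  inL1 g -> (forall n x, `|F n x| <= g x) ->
  {ae mu, forall x, F ^~ x @ \oo --> f x} ->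
  inL1 f /\ (\int[mu]_x F n x)%R @[n --> \oo] --> (\int[mu]_x f x)%R.
Proof.
move=> mF mf ig Fg Ff.
have [] := @dominated_convergence _ _ _ mu setT measurableT
  (fun n => EFin \o F n) (EFin \o f) (EFin \o g).
- by move=> n; apply/measurable_EFinP; exact: mF.
- by apply/measurable_EFinP; exact: mf.
- apply: (@filterS _ _ (ae_filter_ringOfSetsType mu)) Ff => x Fx _.
  by apply: cvg_EFin; [exact: nearW|exact: Fx].
- exact: ig.
- by apply: aeW => x n _; rewrite abse_EFin lee_fin.
move=> if_ _ H; split=> //; rewrite /Rintegral.
apply: fine_cvg; rewrite fineK//.
exact: integrable_fin_num.
Unshelve. all: end_near. Qed.

(** With this sign, [tau (s * t) (w t)] does not depend on [t] when [w] is a free wave of speed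
    [s]. *)
Definition tau a f := fun x => f (x + a).

Lemma measurable_tau a f : measurable_fun setT f -> measurable_fun setT (tau a f).
Proof.
by move=> mf; apply: measurableT_comp => //; apply: measurable_funD.
Qed.

(** The pushforward is a measure that gives []c, d]] its length, and Lebesgue measure is the only
    one. *)
Lemma lebesgue_measure_translation a (A : set R) : measurable A ->
  mu A = pushforward mu (fun x : R => x + a) A.
Proof.
pose s (x : measurableTypeR R) : measurableTypeR R := x + a.
have mt : measurable_fun setT s by apply: measurable_funD.
pose nu : measure (measurableTypeR R) R := measure_function_pushforward__canonical__measure_function_Measure mu mt.
move=> mA; apply: (@lebesgue_measure_unique R nu) => // X [[c d] _ <-] /=.
rewrite /nu /s /pushforward /=.
have -> : (fun x : R => x + a) @^-1` `]c, d] = `]c - a, d - a]%classic.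
  by apply/seteqP; split => x /=; rewrite !in_itv/= ltrBlDr lerBrDr.
rewrite -/mu !lebesgue_measure_itv/= !lte_fin ltrD2r -!EFinB.
by case: ifP => // _; congr EFin; ring.
Qed.

(** Kept apart because it assumes no integrability: applied to the absolute value of a function it
    yields the integrability of the translate, which the signed version [Rint_tau] presupposes. *)
Lemma Rint_tau_ge0 a f : measurable_fun setT f -> (forall x, 0 <= f x) ->
  (\int[mu]_x (f (x + a))%:E = \int[mu]_x (f x)%:E)%E.
Proof.
move=> mf f0.
pose s (x : measurableTypeR R) : measurableTypeR R := x + a.
have mt : measurable_fun setT s by apply: measurable_funD.
have := @ge0_integral_pushforward _ _ _ _ R _ mt mu setT (EFin \o f) measurableT.
rewrite preimage_setT => <-; last 2 first.
- exact/measurable_EFinP.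
- by move=> x _; rewrite lee_fin.
apply/esym; apply: eq_measure_integral => A mA _; exact: lebesgue_measure_translation.
Qed.

Lemma inL1_tau a f : inL1 f -> inL1 (tau a f).
Proof.
move=> hf; have mf := inL1_meas hf; apply/integrableP; split.
  by apply/measurable_EFinP; apply: measurable_tau.
have := @Rint_tau_ge0 a (fun x => `|f x|) _ _.
move: hf => /integrableP[_]; rewrite /tau /= => fo ->//.
exact: measurableT_comp.
Qed.

Lemma Rint_tau a f : inL1 f -> (\int[mu]_x tau a f x = \int[mu]_x f x)%R.
Proof.
move=> hf.
pose s (x : measurableTypeR R) : measurableTypeR R := x + a.
have mt : measurable_fun setT s by apply: measurable_funD.
have mf := inL1_meas hf.
have := @integral_pushforward _ _ _ _ R _ mt mu setT (EFin \o f).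
rewrite preimage_setT => H.
rewrite /Rintegral; congr fine; rewrite -[LHS]H//; last 2 first.
- exact/measurable_EFinP.
- exact: (inL1_tau a hf).
apply/esym; apply: eq_measure_integral => A mA _; exact: lebesgue_measure_translation.
Qed.

Lemma inL2_tau a f : inL2 f -> inL2 (tau a f).
Proof.
move=> hf; apply: inL2I; first by apply: measurable_tau; apply: inL2_meas.
exact: (inL1_tau a (inL2_sqr hf)).
Qed.

Lemma pairing_tau a f g : inL2 f -> inL2 g ->
  pairing (tau a f) (tau a g) = pairing f g.
Proof. by move=> hf hg; apply: (Rint_tau a (inL2_inL1M hf hg)). Qed.

Lemma pairing_tauN a f g : inL2 f -> inL2 g ->
  pairing (tau a f) g = pairing f (tau (- a) g).
Proof.
move=> hf hg; rewrite -(pairing_tau (- a))//; last exact: inL2_tau.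
by congr pairing; apply/funext => x; rewrite /tau subrK.
Qed.

Lemma nrm_tau a f : inL2 f -> nrm (tau a f) = nrm f.
Proof. by move=> hf; rewrite /nrm pairing_tau. Qed.

Lemma tauD a b f : tau a (tau b f) = tau (a + b) f.
Proof. by apply/funext => x; rewrite /tau addrA. Qed.

Lemma pairing_cvg {I : Type} (F : set_system I) (f g : I -> R -> R) f0 g0 :
  Filter F -> (forall i, inL2 (f i)) -> (forall i, inL2 (g i)) ->
  inL2 f0 -> inL2 g0 ->
  nrm (fun x => f i x - f0 x) @[i --> F] --> 0 ->
  nrm (fun x => g i x - g0 x) @[i --> F] --> 0 ->
  pairing (f i) (g i) @[i --> F] --> pairing f0 g0.
Proof.
move=> FF hf hg hf0 hg0 ff gg.
have E i : pairing (f i) (g i) - pairing f0 g0 =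
    pairing (fun x => f i x - f0 x) (fun x => g i x - g0 x)
    + pairing (fun x => f i x - f0 x) g0 + pairing f0 (fun x => g i x - g0 x).
  have h1 := inL2B (hf i) hf0.
  by rewrite pairingBr// !pairingBl// pairingBr//; ring.
apply/subr_cvg0/norm_cvg0P.
apply: (@squeeze_cvgr _ _ _ _ (fun=> 0) (fun i =>
  nrm (fun x => f i x - f0 x) * nrm (fun x => g i x - g0 x)
  + nrm (fun x => f i x - f0 x) * nrm g0 + nrm f0 * nrm (fun x => g i x - g0 x))).
- near=> i; rewrite normr_ge0/= E.
  have h1 := inL2B (hf i) hf0; have h2 := inL2B (hg i) hg0.
  apply: le_trans (ler_normD _ _) _; apply: lerD; last exact: pairing_CS.
  by apply: le_trans (ler_normD _ _) _; apply: lerD; exact: pairing_CS.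
- exact: cvg_cst.
- rewrite [X in _ --> X](_ : _ = 0 * 0 + 0 * nrm g0 + nrm f0 * 0); last by ring.
  apply: cvgD; first apply: cvgD.
  + exact: cvgM.
  + by apply: cvgM => //; exact: cvg_cst.
  + by apply: cvgM => //; exact: cvg_cst.
Unshelve. all: end_near. Qed.

End limits_and_translations.

(** * Smooth functions and test functions *)

Section smooth_functions.
Context {R : realType}.
Local Notation mu := (@lebesgue_measure R).
Implicit Types (f g phi chi : R -> R) (a b c x : R).

Lemma is_deriveI f x d :
  h^-1 * (f (x + h) - f x) @[h --> 0^'] --> d -> is_derive x (1 : R) f d.
Proof.
have E : (fun h : R => h^-1 *: ((f \o shift x) (h *: 1) - f x)) =
         (fun h => h^-1 * (f (x + h) - f x)).
  by apply/funext => h; rewrite /= [h *: 1]mulr1 [x + h]addrC.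
move=> H; apply: DeriveDef; rewrite /derivable /derive /= E.
- by apply/cvg_ex; exists d.
- by apply: cvg_lim H.
Qed.

Lemma is_derive_quot f x d : is_derive x (1 : R) f d ->
  h^-1 * (f (x + h) - f x) @[h --> 0^'] --> d.
Proof.
have E : (fun h : R => h^-1 *: ((f \o shift x) (h *: 1) - f x)) =
         (fun h => h^-1 * (f (x + h) - f x)).
  by apply/funext => h; rewrite /= [h *: 1]mulr1 [x + h]addrC.
move=> [dv <-]; rewrite /derive.
by move: dv; rewrite /derivable /= E.
Qed.

Lemma is_derive_continuous f x d : is_derive x (1 : R) f d -> {for x, continuous f}.
Proof.
by move=> [dv _]; apply: differentiable_continuous; apply/derivable1_diffP.
Qed.

Lemma is_derive_const c x : is_derive x (1 : R) (fun=> c : R) 0.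
Proof. exact: (@is_derive_cst R R R c x 1). Qed.

Lemma is_derive_ext f g x d d' : (forall y, f y = g y) -> d = d' ->
  is_derive x (1 : R) f d -> is_derive x (1 : R) g d'.
Proof. by move=> /funext -> ->. Qed.

Lemma is_derive_near f g x d : (\near x, f x = g x) ->
  is_derive x (1 : R) f d -> is_derive x (1 : R) g d.
Proof. exact: near_eq_is_derive. Qed.

Definition smooth f := forall (k : nat) x, derivable (derive1n k f) x 1.

Lemma smooth_is_derive f x : smooth f -> is_derive x (1 : R) f (derive1 f x).
Proof. by move=> /(_ 0%N x) H; apply: DeriveDef => //; rewrite derive1E. Qed.

Lemma smooth_derive1 f : smooth f -> smooth (derive1 f).
Proof. by move=> sf k x; rewrite -derive1Sn; apply: sf. Qed.

Lemma smooth_continuous f : smooth f -> continuous f.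
Proof. by move=> sf x; apply: is_derive_continuous (smooth_is_derive x sf). Qed.

Lemma is_derive_derive1 f x d : is_derive x (1 : R) f d -> derive1 f x = d.
Proof. by move=> [_ <-]; rewrite derive1E. Qed.

Lemma smooth_stable (P : (R -> R) -> Prop) :
  (forall f, P f -> exists2 f', P f' & forall x, is_derive x (1 : R) f (f' x)) ->
  forall f, P f -> smooth f.
Proof.
move=> H f Pf k.
have Pk : P (derive1n k f).
  elim: k => [//|k IH]; rewrite derive1nS.
  have [f' Pf' df] := H _ IH.
  by rewrite (_ : derive1 _ = f')//; apply/funext => x; exact: is_derive_derive1.
by have [f' _ df] := H _ Pk => x; have [] := df x.
Qed.

(* The derivatives of exp(-1/x) on x > 0 are of the form p(1/x) exp(-1/x). *)
Definition flat (p : {poly R}) x := if 0 < x then p.[x^-1] * expR (- x^-1) else 0.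

(** Termwise, y^i <= i! e^y, since y^i / i! is one term of the exponential series. *)
Lemma poly_le_expR (p : {poly R}) :
  exists2 C, 0 <= C & forall y, 0 <= y -> `|p.[y]| <= C * expR y.
Proof.
exists (\sum_(i < size p) `|p`_i| * i`!%:R).
  by apply: sumr_ge0 => i _; rewrite mulr_ge0.
move=> y y0; rewrite horner_coef mulr_suml.
apply: le_trans (ler_norm_sum _ _ _) _; apply: ler_sum => i _.
rewrite normrM -mulrA ler_wpM2l// normrX ger0_norm//.
case: (i : nat) => [|n]; first by rewrite expr0 fact0 mul1r -expR0 ler_expR.
have := expR_ge1Dxn n y0 => H.
have f0 : 0 < n.+1`!%:R :> R by rewrite ltr0n fact_gt0.
rewrite -ler_pdivrMl// mulrC (le_trans _ H)// lerDr; exact: ler01.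
Qed.

(** Put y = 1/x in the exponential bound for ['X * p]; the extra factor ['X] is what produces the
    factor x on the right. *)
Lemma flat_bound (p : {poly R}) :
  exists2 C, 0 <= C & forall x, `|flat p x| <= C * `|x|.
Proof.
have [C C0 H] := poly_le_expR ('X * p); exists C => // x; rewrite /flat.
case: ifPn => [x0|_]; last by rewrite normr0 mulr_ge0.
have := H x^-1; rewrite invr_ge0 => /(_ (ltW x0)).
rewrite hornerM hornerX !normrM (gtr0_norm (expR_gt0 _)) expRN normfV.
rewrite (gtr0_norm x0) ler_pdivrMr ?expR_gt0// => H1.
by rewrite mulrAC -ler_pdivrMr// mulrC.
Qed.

(** With y = 1/x and dy/dx = - y^2, the derivative of p(y) e^(-y) is y^2 (p(y) - p'(y)) e^(-y). At 0
    the difference quotient of [flat p] is again a flat function, that of ['X * p], so its linear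
    bound makes it tend to 0. *)
Lemma is_derive_flat (p : {poly R}) x :
  is_derive x (1 : R) (flat p) (flat ('X^2 * (p - p^`())) x).
Proof.
have [x0|x0|->] := ltgtP x 0.
- have -> : flat ('X^2 * (p - p^`())) x = 0 by rewrite /flat ltNge ltW.
  have d0 := is_derive_const 0 x; apply: is_derive_near d0.
  near=> y; rewrite /flat ltNge ltW//.
  by near: y; exact: lt_nbhsl.
- rewrite {2}/flat x0.
  apply: (@is_derive_near (fun y => p.[y^-1] * expR (- y^-1))).
    near=> y; rewrite /flat ifT//.
    by near: y; exact: lt_nbhsr.
  have dV : is_derive x (1 : R) (fun y : R => y^-1) (- x ^- 2).
    have := @is_deriveV R id x 1 1 (lt0r_neq0 x0) (is_derive_id x (1 : R)).
    by apply: is_derive_ext => //; rewrite [_ *: _]mulr1.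
  have dP : is_derive x (1 : R) (fun y : R => p.[y^-1]) (p^`().[x^-1] * - x ^- 2).
    exact: (@is_derive1_comp R (horner p) (fun y => y^-1)).
  have dE : is_derive x (1 : R) (fun y : R => expR (- y^-1)) (expR (- x^-1) * x ^- 2).
    have dN := is_deriveN dV; rewrite opprK in dN.
    exact: (@is_derive1_comp R expR (fun y => - y^-1)).
  have := is_deriveM dP dE; apply: is_derive_ext => //.
  rewrite !hornerE /= -[_ *: _]/(_ * _) -[X in _ + X]/(_ * _) exprVn; ring.
- have -> : flat ('X^2 * (p - p^`())) 0 = 0 by rewrite /flat ltxx.
  apply: is_deriveI; have [C C0 H] := flat_bound ('X * p).
  apply/norm_cvg0P.
  apply: (@squeeze_cvgr _ _ _ _ (fun=> 0) (fun h : R => C * `|h|)).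
  + near=> h; rewrite normr_ge0/= (le_trans _ (H h))// add0r.
    rewrite {2}/flat ltxx subr0 /flat; case: ifP => _; last by rewrite mulr0.
    by rewrite hornerM hornerX mulrA.
  + exact: cvg_cst.
  + rewrite -[X in _ --> X](mulr0 C); apply: cvgM; first exact: cvg_cst.
    apply/norm_cvg0P; exact: cvg_within.
Unshelve. all: end_near. Qed.

(* All constructions below stay in this class, which is stable under
   differentiation; by [smooth_stable] its members are smooth. *)
Inductive smooth_expr : (R -> R) -> Prop :=
| SE_smooth f of smooth f : smooth_expr f
| SE_flat p : smooth_expr (flat p)
| SE_cst c : smooth_expr (fun=> c)
| SE_add f g of smooth_expr f & smooth_expr g : smooth_expr (fun x => f x + g x)
| SE_mul f g of smooth_expr f & smooth_expr g : smooth_expr (fun x => f x * g x)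
| SE_inv f of smooth_expr f & (forall x, f x != 0) : smooth_expr (fun x => (f x)^-1)
| SE_affine a b f of smooth_expr f : smooth_expr (fun x => f (a * x + b)).

Lemma smooth_exprP f : smooth_expr f -> smooth f.
Proof.
apply: smooth_stable => {}f; elim => {f}.
- move=> f sf; exists (derive1 f); first by apply/SE_smooth/smooth_derive1.
  by move=> x; apply: smooth_is_derive.
- move=> p; exists (flat ('X^2 * (p - p^`()))); first exact: SE_flat.
  exact: is_derive_flat.
- move=> c; exists (fun=> 0); first exact: SE_cst.
  by move=> x; exact: is_derive_cst.
- move=> f g sf [f' sf' df] sg [g' sg' dg].
  exists (fun x => f' x + g' x); first exact: SE_add.
  by move=> x; apply: is_deriveD.
- move=> f g sf [f' sf' df] sg [g' sg' dg].
  exists (fun x => f x * g' x + g x * f' x).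
    by apply: SE_add; exact: SE_mul.
  by move=> x; apply: is_deriveM.
- move=> f sf [f' sf' df] f0.
  exists (fun x => -1 * ((f x)^-1 * (f x)^-1) * f' x).
    apply: SE_mul => //; apply: SE_mul; first exact: SE_cst.
    by apply: SE_mul; exact: SE_inv.
  move=> x; have := is_deriveV (f0 x) (df x); apply: is_derive_ext => //.
  by rewrite -[_ *: _]/(_ * _) -exprVn; ring.
- move=> a b f sf [f' sf' df].
  exists (fun x => a * f' (a * x + b)).
    by apply: SE_mul; [exact: SE_cst|exact: SE_affine].
  move=> x.
  have da : is_derive x (1 : R) (fun y => a * y + b) a.
    have := is_deriveD (is_deriveZ a (is_derive_id x (1 : R))) (is_derive_cst b x 1).
    by apply: is_derive_ext => //; rewrite addr0 -[_ *: _]/(_ * _) mulr1.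
  have := @is_derive1_comp R f _ x _ _ (df _) da.
  by apply: is_derive_ext => //; rewrite mulrC.
Qed.

Lemma smooth_cst c : smooth (fun=> c).
Proof. exact/smooth_exprP/SE_cst. Qed.

Lemma smoothD f g : smooth f -> smooth g -> smooth (fun x => f x + g x).
Proof. by move=> sf sg; apply/smooth_exprP/SE_add; exact: SE_smooth. Qed.

Lemma smoothM f g : smooth f -> smooth g -> smooth (fun x => f x * g x).
Proof. by move=> sf sg; apply/smooth_exprP/SE_mul; exact: SE_smooth. Qed.

Lemma smooth_affine a b f : smooth f -> smooth (fun x => f (a * x + b)).
Proof. by move=> sf; apply/smooth_exprP/SE_affine; exact: SE_smooth. Qed.

(** The usual smooth transition from 0 on x <= 0 to 1 on x >= 1. The two terms of the denominator
    never vanish together; [-1 * x + 1] has the shape required by [SE_affine]. *)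
Definition step x := flat 1 x / (flat 1 x + flat 1 (-1 * x + 1)).

Lemma flat1E x : flat 1 x = if 0 < x then expR (- x^-1) else 0.
Proof. by rewrite /flat hornerC mul1r. Qed.

Lemma flat1_ge0 x : 0 <= flat 1 x.
Proof. by rewrite flat1E; case: ifP => // _; exact: expR_ge0. Qed.

Lemma flat1_gt0 x : 0 < x -> 0 < flat 1 x.
Proof. by rewrite flat1E => ->; exact: expR_gt0. Qed.

Lemma step_den_gt0 x : 0 < flat 1 x + flat 1 (-1 * x + 1).
Proof.
have [x0|x0] := ltP 0 x.
  by rewrite ltr_pwDl ?flat1_ge0// flat1_gt0.
by rewrite ltr_wpDl ?flat1_ge0// flat1_gt0//; lra.
Qed.

Lemma smooth_step : smooth step.
Proof.
apply/smooth_exprP/SE_mul; first exact: SE_flat.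
apply: SE_inv; last by move=> x; rewrite gt_eqF ?step_den_gt0.
by apply: SE_add; [exact: SE_flat|apply: SE_affine; exact: SE_flat].
Qed.

Lemma step_itv x : 0 <= step x <= 1.
Proof.
rewrite divr_ge0 ?flat1_ge0 ?(ltW (step_den_gt0 _))//=.
by rewrite ler_pdivrMr ?step_den_gt0// mul1r lerDl flat1_ge0.
Qed.

Lemma step_le0 x : x <= 0 -> step x = 0.
Proof. by move=> x0; rewrite /step {1}flat1E ltNge x0/= mul0r. Qed.

Lemma step_ge1 x : 1 <= x -> step x = 1.
Proof.
move=> x1; rewrite /step [flat 1 (-1 * x + 1)]flat1E ifF ?addr0.
  by rewrite divff// gt_eqF// flat1_gt0//; lra.
by apply/negbTE; rewrite -leNgt; lra.
Qed.

Lemma test_smooth phi : test_function phi -> smooth phi.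
Proof. by case. Qed.

Lemma test_support phi : test_function phi ->
  exists2 K, 0 < K & forall x, K < `|x| -> phi x = 0.
Proof.
move=> [_ /compact_bounded[M [Mr HM]]].
exists (Num.max 1 (M + 1)); first by rewrite lt_max ltr01.
move=> x Kx; apply/eqP; rewrite -[_ == _]negbK; apply/negP => p0.
have /HM/(_ x) : M < Num.max 1 (M + 1) by rewrite lt_max ltrDl ltr01 orbT.
have /[swap]/[apply] : closure [set x | phi x != 0] x by apply: subset_closure.
by rewrite /= leNgt Kx.
Qed.

Lemma test_functionI phi K : smooth phi -> (forall x, K < `|x| -> phi x = 0) ->
  test_function phi.
Proof.
move=> sp H; split=> //.
apply: (@subclosed_compact _ _ `[- K, K]%classic).
- exact: closed_closure.
- exact: segment_compact.
- have /closure_id -> : closed (`[- K, K]%classic : set R) by exact: itv_closed.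
  apply: closureS => x /= p0; rewrite in_itv/= -ler_norml leNgt.
  by apply/negP => /H px; move: p0; rewrite px eqxx.
Qed.

Lemma testM chi phi : smooth chi -> test_function phi ->
  test_function (fun x => chi x * phi x).
Proof.
move=> sc tp; have [K K0 H] := test_support tp.
apply: (@test_functionI _ K); first by apply: smoothM => //; exact: test_smooth.
by move=> x /H ->; rewrite mulr0.
Qed.

Lemma testZ c phi : test_function phi -> test_function (fun x => c * phi x).
Proof. by move=> tp; apply: testM => //; exact: smooth_cst. Qed.

Lemma testD phi chi : test_function phi -> test_function chi ->
  test_function (fun x => phi x + chi x).
Proof.
move=> tp tc; have [K K0 H] := test_support tp; have [L L0 HL] := test_support tc.
apply: (@test_functionI _ (Num.max K L)); first by apply: smoothD; exact: test_smooth.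
by move=> x; rewrite gt_max => /andP[/H -> /HL ->]; rewrite addr0.
Qed.

Lemma test_affine a b phi : a != 0 -> test_function phi ->
  test_function (fun x => phi (a * x + b)).
Proof.
move=> a0 tp; have [K K0 H] := test_support tp.
have an : 0 < `|a| by rewrite normr_gt0.
apply: (@test_functionI _ ((K + `|b|) / `|a|)).
  by apply: smooth_affine; exact: test_smooth.
move=> x; rewrite ltr_pdivrMr// mulrC -normrM => h; apply: H.
by have := ler_normB (a * x + b) b; rewrite addrK; lra.
Qed.

Lemma test_tau a phi : test_function phi -> test_function (tau a phi).
Proof.
move=> /(@test_affine 1 a _ (oner_neq0 _)); congr test_function.
by apply/funext => x; rewrite mul1r.
Qed.

Lemma test_derive1 phi : test_function phi -> test_function (derive1 phi).
Proof.
move=> tp; have [K K0 H] := test_support tp.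
apply: (@test_functionI _ K); first by apply: smooth_derive1; exact: test_smooth.
move=> x Kx; apply: is_derive_derive1.
have d0 := is_derive_const 0 x; apply: is_derive_near d0.
near=> y; rewrite H//; near: y.
by apply: (@cvgr_gt _ _ _ _ (fun y : R => `|y|)) Kx; exact: norm_continuous.
Unshelve. all: end_near. Qed.

Lemma test_bounded phi : test_function phi ->
  exists2 M, 0 < M & forall x, `|phi x| <= M.
Proof.
move=> tp; have [K K0 H] := test_support tp.
have cp : {within `[- K, K], continuous (fun x => `|phi x|)}.
  apply: continuous_subspaceT => x; apply: continuous_comp.
    exact: (smooth_continuous (test_smooth tp)).
  exact: norm_continuous.
have NK : - K <= K by lra.
have [c _ Hc] := EVT_max NK cp.
exists (`|phi c| + 1); first by rewrite ltr_wpDl.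
move=> x; have [Kx|Kx] := ltP K `|x|; first by rewrite H// normr0 addr_ge0.
by rewrite (le_trans (Hc x _)) ?lerDl ?ler01// in_itv/= -ler_norml.
Qed.

Lemma test_measurable phi : test_function phi -> measurable_fun setT phi.
Proof.
by move=> tp; apply: continuous_measurable_fun; apply/smooth_continuous/test_smooth.
Qed.

Lemma inL1_itv K : inL1 (\1_(`[- K, K]%classic : set R)).
Proof.
apply: (@eq_integrable _ _ _ mu setT measurableT (fun x => (\1_`[- K, K] x)%:E)) => //.
apply: integrable_indic_itv.
Qed.

Lemma bdd_support_L2 f K M : measurable_fun setT f -> 0 <= K -> 0 <= M ->
  (forall x, `|f x| <= M) -> (forall x, K < `|x| -> f x = 0) ->
  inL2 f /\ nrm f <= M * Num.sqrt (K *+ 2).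
Proof.
move=> mf K0 M0 fM fK.
have i1 := inL1Z (M ^+ 2) (inL1_itv K).
have E x : f x ^+ 2 <= M ^+ 2 * \1_`[- K, K] x.
  rewrite indicE; have [Kx|Kx] := ltP K `|x|.
    rewrite fK// expr0n mulr_ge0// sqr_ge0//.
  rewrite mem_set/= ?in_itv/= -?ler_norml// mulr1.
  by rewrite -real_normK ?num_real// lerXn2r ?nnegrE.
have f2 : inL2 f.
  apply: inL2I => //; apply: inL1_le i1 _; first exact: measurable_funX.
  by move=> x; rewrite ger0_norm ?sqr_ge0.
split=> //; rewrite /nrm -[M in leRHS]ger0_norm// -sqrtr_sqr -sqrtrM ?sqr_ge0//.
rewrite ler_sqrt ?mulr_ge0 ?sqr_ge0 ?mulrn_wge0//.
have -> : K *+ 2 = (\int[mu]_x \1_`[- K, K] x)%R.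
  rewrite /Rintegral integral_indic//= setIT lebesgue_measure_itv/= lte_fin.
  by case: ifPn => [_|]; rewrite ?opprK ?mulr2n//= -leNgt => h; lra.
rewrite -RintZ; last exact: inL1_itv.
by apply: le_Rint => //; exact: inL2_inL1M.
Qed.

Lemma test_L2 phi : test_function phi -> inL2 phi.
Proof.
move=> tp; have [K K0 H] := test_support tp; have [M M0 HM] := test_bounded tp.
exact: (bdd_support_L2 (test_measurable tp) (ltW K0) (ltW M0) HM H).1.
Qed.

End smooth_functions.

(** * Density of the test functions in L2 *)

Section cell_averages.
Context {R : realType}.
Local Notation mu := (@lebesgue_measure R).
Implicit Types (f g phi : R -> R) (a b c x : R).

(** On a compact set |f| <= 1 + f^2, and both terms are integrable there. *)
Lemma inL2_locally_integrable f : inL2 f -> locally_integrable setT f.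
Proof.
move=> hf; have mf := inL2_meas hf; split=> //; first exact: openT.
move=> K _ cK; have mK : measurable K by apply: compact_measurable.
apply: (@le_lt_trans _ _ (\int[mu]_(x in K) (1%:E + (f x ^+ 2)%:E))%E).
  apply: ge0_le_integral => //.
  - by do 2 apply: measurableT_comp => //; exact: measurable_funTS.
  - apply: emeasurable_funD => //; apply/measurable_EFinP.
    by apply: measurable_funX; exact: measurable_funTS.
  - move=> x _; rewrite -EFinD lee_fin -[f x ^+ 2]real_normK ?num_real//.
    by set y := `|f x|; have := sqr_ge0 (y - 1); nra.
rewrite ge0_integralD//; last 2 first.
- by move=> x _; rewrite lee_fin sqr_ge0.
- by apply/measurable_EFinP/measurable_funX; exact: measurable_funTS.
apply: lte_add_pinfty.
  by rewrite integral_cst// mul1e; exact: compact_finite_measure.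
apply: (@le_lt_trans _ _ (\int[mu]_x (f x ^+ 2)%:E)%E).
  apply: ge0_subset_integral => //.
  - by apply/measurable_EFinP/measurable_funX.
  - by move=> x _; rewrite lee_fin sqr_ge0.
by rewrite -EFin_Rint ?ltry//; exact: inL2_sqr.
Qed.

(** Half-open, so that for fixed [n] the cells partition the line and membership is decided by a
    floor. *)
Definition cell (n : nat) (m : int) : set R :=
  `[m%:~R / n.+1%:R, (m + 1)%:~R / n.+1%:R[%classic.

Lemma cellP n m x : cell n m x <-> Num.floor (n.+1%:R * x) = m.
Proof.
have n0 : 0 < n.+1%:R :> R by rewrite ltr0n.
rewrite /cell /= in_itv/= ler_pdivrMr// ltr_pdivlMr// mulrC.
by split=> [H|<-]; [apply/eqP; rewrite floor_eq|exact: floor_itv].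
Qed.

Lemma measurable_cell n m : measurable (cell n m).
Proof. exact: measurable_itv. Qed.

Lemma measure_cell n m : mu (cell n m) = (n.+1%:R^-1)%:E.
Proof.
rewrite /cell lebesgue_measure_itv/= lte_fin ltr_pM2r ?invr_gt0 ?ltr0n//.
by rewrite ltr_int ltrDl ltr01 -EFinD -mulrBl -rmorphB/= addrC addKr mul1r.
Qed.

Lemma cell_nicely_shrinking x :
  nicely_shrinking x (fun n => cell n (Num.floor (n.+1%:R * x))).
Proof.
split=> [n|]; first exact: measurable_cell.
have p n : 0 < n.+1%:R^-1 :> R by rewrite invr_gt0 ltr0n.
(* The cell containing [x] lies in the ball of radius 1/(n+1) about [x], whose measure is twice that
   of the cell. *)
exists (2, fun n => PosNum (p n)); split => //=.
- exact: cvg_harmonic.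
- move=> n y /cellP Hy.
  have n0 : 0 < n.+1%:R :> R by rewrite ltr0n.
  have := floor_itv (n.+1%:R * x); have := floor_itv (n.+1%:R * y).
  rewrite Hy intrD /ball/= => /andP[h1 h2] /andP[h3 h4].
  rewrite -(ltr_pM2l n0) mulfV ?gt_eqF// -[X in X * `|_|]gtr0_norm// -normrM.
  by rewrite ltr_norml mulrBr; lra.
- move=> n; rewrite measure_cell lebesgue_measure_ball; last exact: ltW.
  by rewrite -EFinM lee_fin mulr_natl.
Qed.

Lemma Rint_indic_mul f (A : set R) : measurable A ->
  (\int[mu]_x (\1_A x * f x) = \int[mu]_(x in A) f x)%R.
Proof.
move=> mA; rewrite [RHS]Rintegral_mkcond; apply: eq_Rintegral => x _.
by rewrite patchE indicE; case: ifP => _; rewrite ?mul1r ?mul0r.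
Qed.

(** Lebesgue differentiation along the cells. It serves twice: for the pointwise convergence of
    [grid_proj], and in the Sobolev inequality, to pass from averages to values. *)
Lemma cell_average_cvg f : locally_integrable setT f ->
  {ae mu, forall x, n.+1%:R *
    (\int[mu]_y (\1_(cell n (Num.floor (n.+1%:R * x))) y * f y))%R
      @[n --> \oo] --> f x}.
Proof.
move=> lf; apply: (@filterS _ _ (ae_filter_ringOfSetsType mu)) (lebesgue_differentiation lf).
move=> x fx.
have := nice_lebesgue_differentiation cell_nicely_shrinking lf fx.
move=> /fine_cvgP[_]; apply: cvg_trans; apply: near_eq_cvg; near=> n => /=.
rewrite Rint_indic_mul; last exact: measurable_cell.
rewrite measure_cell fineM//.
- by rewrite inver gt_eqF ?invr_gt0 ?ltr0n//= invrK.
- by rewrite inver gt_eqF ?invr_gt0 ?ltr0n//=.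
- apply: (@integrable_fin_num _ _ _ mu _ (measurable_cell _ _) (EFin \o f)).
  apply/integrableP; split.
    by apply/measurable_EFinP; case: lf => mf _ _; exact: measurable_funTS.
  case: lf => mf _ /(_ `[(Num.floor (n.+1%:R * x))%:~R / n.+1%:R,
    (Num.floor (n.+1%:R * x) + 1)%:~R / n.+1%:R]%classic) H.
  apply: le_lt_trans (H _ _) => //; last exact: segment_compact.
  apply: ge0_subset_integral => //.
  + exact: measurable_cell.
  + apply: measurableT_comp => //; apply/measurable_EFinP; exact: measurable_funTS.
  + by move=> y; rewrite /cell /= !in_itv/= => /andP[-> /ltW ->].
Unshelve. all: end_near. Qed.

Lemma ae_le_of_cell_average f M : inL1 f ->
  (forall n m, (\int[mu]_y (\1_(cell n m) y * f y) <= M / n.+1%:R)%R) ->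
  {ae mu, forall x, f x <= M}.
Proof.
move=> hf H; have lf : locally_integrable setT f by apply: open_integrable_locally => //; exact: openT.
apply: (@filterS _ _ (ae_filter_ringOfSetsType mu)) (cell_average_cvg lf) => x fx.
apply: (@ler_cvg_to _ _ _ _ _ (fun=> M) _ _ fx); first exact: cvg_cst.
by near=> n; rewrite mulrC -ler_pdivlMr ?ltr0n.
Unshelve. all: end_near. Qed.

Lemma inL1_indic (A : set R) : measurable A -> (mu A < +oo)%E -> inL1 \1_A.
Proof.
move=> mA Af; apply/integrableP; split; first by apply/measurable_EFinP; exact: measurable_indic.
under eq_integral do rewrite /= ger0_norm//.
by rewrite integral_indic//= setIT.
Qed.

Lemma indic_sqr (A : set R) x : \1_A x ^+ 2 = \1_A x :> R.
Proof. by rewrite indicE; case: (x \in A); rewrite ?expr1n ?expr0n. Qed.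

Lemma inL2_cell n m : inL2 (\1_(cell n m)).
Proof.
apply: inL2I; first by apply: measurable_indic; exact: measurable_cell.
have : inL1 (\1_(cell n m)).
  by apply: inL1_indic; [exact: measurable_cell|rewrite measure_cell ltry].
by apply: eq_integrable => // x _ /=; rewrite indic_sqr.
Qed.

Lemma pairing_cell n m k : pairing (\1_(cell n m)) (\1_(cell n k)) =
  if m == k then n.+1%:R^-1 else 0 :> R.
Proof.
case: eqP => [->|mk].
  transitivity (\int[mu]_x (\1_(cell n k) x : R))%R.
    by apply: eq_Rint => x; rewrite -expr2 indic_sqr.
  rewrite /Rintegral integral_indic ?setIT; [exact: (congr1 fine (measure_cell n k))| |] => //.
  exact: measurable_cell.
rewrite /pairing (@eq_Rint _ _ (fun=> 0)).
  by rewrite /Rintegral integral0.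
move=> x; rewrite !indicE; case: (boolP (x \in cell n m)) => [|_]; last by rewrite mul0r.
rewrite inE => /cellP xm; case: (boolP (x \in cell n k)) => [|_]; last by rewrite mulr0.
by rewrite inE => /cellP xk; case: mk; rewrite -xm -xk.
Qed.

Lemma inL2_sum (N : nat) (c : nat -> R) (e : nat -> R -> R) :
  (forall i, inL2 (e i)) -> inL2 (fun x => \sum_(i < N) c i * e i x).
Proof.
move=> he; elim: N => [|N IH].
  have -> : (fun x => \sum_(i < 0) c i * e i x) = (fun x => 0 * e 0%N x).
    by apply/funext => x; rewrite big_ord0 mul0r.
  exact: inL2Z.
have -> : (fun x => \sum_(i < N.+1) c i * e i x) =
    (fun x => (\sum_(i < N) c i * e i x) + c N * e N x).
  by apply/funext => x; rewrite big_ord_recr.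
by apply: inL2D => //; exact: inL2Z.
Qed.

Lemma pairing_suml (N : nat) (c : nat -> R) (e : nat -> R -> R) g :
  (forall i, inL2 (e i)) -> inL2 g ->
  pairing (fun x => \sum_(i < N) c i * e i x) g = \sum_(i < N) c i * pairing (e i) g.
Proof.
move=> he hg; elim: N => [|N IH].
  rewrite big_ord0 /pairing (@eq_Rint _ _ (fun=> 0)) ?/Rintegral ?integral0//.
  by move=> x; rewrite big_ord0 mul0r.
rewrite big_ord_recr/= -IH -pairingZl// -pairingDl//.
- by congr pairing; apply/funext => x; rewrite big_ord_recr.
- exact: inL2_sum.
- exact: inL2Z.
Qed.

(* The cells of length 1/(n+1) that tile [-(n+1), n+1[, numbered from 0. *)
Definition gcell n (k : nat) := cell n (k%:Z - (n.+1 ^ 2)%:Z).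

(* Orthogonal projection onto step functions.  Being a contraction of L^2 that
   converges pointwise almost everywhere (Lebesgue differentiation), it converges
   in L^2. *)
Definition grid_proj n f x := \sum_(k < 2 * n.+1 ^ 2)
  (n.+1%:R * pairing (\1_(gcell n k)) f) * \1_(gcell n k) x.

Lemma inL2_grid_proj n f : inL2 (grid_proj n f).
Proof. by apply: (@inL2_sum _ (fun k => n.+1%:R * pairing (\1_(gcell n k)) f) (fun k => \1_(gcell n k))) => i; exact: inL2_cell. Qed.

Lemma pairing_grid_proj n f g : inL2 g -> pairing (grid_proj n f) g =
  \sum_(k < 2 * n.+1 ^ 2) (n.+1%:R * pairing (\1_(gcell n k)) f) * pairing (\1_(gcell n k)) g.
Proof.
move=> hg; apply: (@pairing_suml _ (fun k => n.+1%:R * pairing (\1_(gcell n k)) f) (fun k => \1_(gcell n k))) => // i.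
exact: inL2_cell.
Qed.

(** The indicators of distinct cells are orthogonal, with squared norm 1/(n+1) compensated by the
    factor n+1, so the projection is orthogonal to the error. The distance to [f] is thereby
    controlled by a lower bound on the norm of the projection, which pointwise convergence can
    provide. *)
Lemma grid_proj_pyth n f : inL2 f ->
  nrm (fun x => f x - grid_proj n f x) ^+ 2 = nrm f ^+ 2 - nrm (grid_proj n f) ^+ 2.
Proof.
move=> hf; have hp := inL2_grid_proj n f.
rewrite !nrm_sqr pairingBl ?pairingBr//; try exact: inL2B.
rewrite (pairingC f (grid_proj n f)).
suff -> : pairing (grid_proj n f) (grid_proj n f) = pairing (grid_proj n f) f by ring.
rewrite pairing_grid_proj// pairing_grid_proj//; apply: eq_bigr => i _.
congr (_ * _); rewrite pairingC pairing_grid_proj; last exact: inL2_cell.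
rewrite (bigD1 i)//= pairing_cell eqxx big1 ?addr0.
  by rewrite mulrAC mulfV ?mul1r// pnatr_eq0.
move=> j ji; rewrite pairing_cell ifF ?mulr0//.
apply/negbTE; apply: contra ji => /eqP/addIr[ji].
by apply/eqP/val_inj.
Qed.

Lemma grid_proj_val n f x : `|x| < n.+1%:R -> grid_proj n f x =
  n.+1%:R * (\int[mu]_y (\1_(cell n (Num.floor (n.+1%:R * x))) y * f y))%R.
Proof.
move=> xn; set m := Num.floor _.
have n0 : 0 < n.+1%:R :> R by rewrite ltr0n.
(* Since |x| < n+1, the index [m] lies in [-(n+1)^2, (n+1)^2[; shifted by (n+1)^2 it is one of the 2
   (n+1)^2 summands. *)
have m0 : 0 <= m + (n.+1 ^ 2)%:Z.
  rewrite -lerBlDr sub0r floor_ge_int rmorphN/= -pmulrn natrX expr2 -mulrN ler_pM2l//.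
  by move: xn; rewrite ltr_norml => /andP[/ltW].
have mlt : (`|(m + (n.+1 ^ 2)%:Z)%R|%N < 2 * n.+1 ^ 2)%N.
  rewrite -ltz_nat gez0_abs// mul2n -addnn PoszD ltrD2r.
  have /andP[h _] := floor_itv (n.+1%:R * x).
  rewrite -(ltr_int R) (le_lt_trans h)// -pmulrn natrX expr2 ltr_pM2l//.
  by move: xn; rewrite ltr_norml => /andP[].
have Hx : gcell n `|(m + (n.+1 ^ 2)%:Z)%R|%N = cell n m by rewrite /gcell gez0_abs// addrK.
rewrite /grid_proj (bigD1 (Ordinal mlt))//= Hx big1 ?addr0.
  by rewrite [X in _ * X]indicE mem_set ?mulr1//; apply/cellP.
move=> i ni; rewrite [X in _ * X]indicE memNset ?mulr0// => /cellP im.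
move: ni => /negP; apply; apply/eqP/val_inj => /=.
by move: im; rewrite -/m => ->; rewrite subrK.
Qed.

Lemma grid_proj_cvg f : inL2 f -> {ae mu, forall x, grid_proj n f x @[n --> \oo] --> f x}.
Proof.
move=> hf; apply: (@filterS _ _ (ae_filter_ringOfSetsType mu)) (cell_average_cvg (inL2_locally_integrable hf)).
move=> x; apply: cvg_trans; apply: near_eq_cvg; near=> n.
rewrite grid_proj_val//; near: n; exists (Num.truncn `|x|) => // n /= xn.
by rewrite (lt_le_trans (truncnS_gt _))// ler_nat ltnS.
Unshelve. all: end_near. Qed.

Let trunc_sqr (m : nat) f x := Num.min (f x ^+ 2) m%:R * \1_(`[- m%:R, m%:R]%classic : set R) x.

Let measurable_trunc_sqr m f : measurable_fun setT f -> measurable_fun setT (trunc_sqr m f).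
Proof.
move=> mf; apply: measurable_funM; last exact: measurable_indic.
by apply: measurable_minr => //; exact: measurable_funX.
Qed.

Let trunc_sqr_le m f x : `|trunc_sqr m f x| <= f x ^+ 2.
Proof.
rewrite /trunc_sqr normrM ger0_norm; last by rewrite le_min sqr_ge0 ler0n.
rewrite -[leRHS]mulr1 ler_pM//; first by rewrite le_min sqr_ge0 ler0n.
  by rewrite ge_min lexx.
by rewrite indicE; case: (_ \in _); rewrite ?normr1 ?normr0.
Qed.

(* Fatou's lemma in disguise: the truncations allow dominated convergence. *)
Lemma nrm_grid_proj_lim f e : inL2 f -> 0 < e ->
  exists n, nrm f ^+ 2 - e < nrm (grid_proj n f) ^+ 2.
Proof.
move=> hf e0; have mf := inL2_meas hf.
have sqrE g : nrm g ^+ 2 = (\int[mu]_x (g x ^+ 2))%R.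
  by rewrite nrm_sqr; apply: eq_Rint => x; rewrite expr2.
have i_trunc m g : inL2 g -> inL1 (trunc_sqr m g).
  move=> hg; apply: inL1_le (inL2_sqr hg) _ => //.
  by apply: measurable_trunc_sqr; exact: inL2_meas.
(* The truncation level is fixed first, at the cost of e/2 in the squared norm; only afterwards does
   [n] vary. *)
have [m Hm] : exists m, nrm f ^+ 2 - e / 2 < (\int[mu]_x trunc_sqr m f x)%R.
  have H : {ae mu, forall x, trunc_sqr m f x @[m --> \oo] --> f x ^+ 2}.
    apply: aeW => x; apply: cvg_near_cst; near=> m.
    have h1 : f x ^+ 2 <= m%:R by near: m; exact: nbhs_infty_ger.
    have h2 : `|x| <= m%:R by near: m; exact: nbhs_infty_ger.
    rewrite /trunc_sqr (min_idPl h1) indicE mem_set ?mulr1//=.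
    by rewrite in_itv/= -ler_norml.
  have [_] := @Rint_cvg R (fun m => trunc_sqr m f) (fun x => f x ^+ 2) (fun x => f x ^+ 2)
    (fun m => measurable_trunc_sqr m mf) (measurable_funX 2 mf) (inL2_sqr hf)
    (fun m x => trunc_sqr_le m f x) H.
  rewrite -sqrE => /cvgrPdist_lt /(_ (e / 2)); rewrite divr_gt0// => /(_ isT)[m _ /(_ m (leqnn _))].
  by rewrite /= ltr_norml => /andP[_ h]; exists m; lra.
(* At a fixed level all truncated squares are dominated by [m] times the indicator of [-m, m], so
   convergence almost everywhere suffices. *)
have : (\int[mu]_x trunc_sqr m (grid_proj n f) x)%R @[n --> \oo] --> (\int[mu]_x trunc_sqr m f x)%R.
  apply: (@Rint_cvg R (fun n => trunc_sqr m (grid_proj n f)) (trunc_sqr m f)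
  (fun x => m%:R * \1_`[- m%:R, m%:R] x) _ (measurable_trunc_sqr m mf) _ _ _).2.
- move=> n; apply: measurable_trunc_sqr; exact: (inL2_meas (inL2_grid_proj n f)).
- by apply: inL1Z; exact: inL1_itv.
- move=> n x; rewrite /trunc_sqr normrM ger0_norm; last by rewrite le_min sqr_ge0 ler0n.
  by rewrite [`|\1__ _|]ger0_norm// ler_wpM2r// ge_min lexx orbT.
- apply: (@filterS _ _ (ae_filter_ringOfSetsType mu)) (grid_proj_cvg hf) => x fx.
  apply: cvgM; last exact: cvg_cst.
  have minE (y : R) : Num.min y m%:R = (y + m%:R - `|y - m%:R|) / 2 by rewrite minr_absE.
  under eq_fun do rewrite minE.
  rewrite minE; apply: cvgM; last exact: cvg_cst.
  have c2 : grid_proj n f x ^+ 2 @[n --> \oo] --> f x ^+ 2.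
    by rewrite expr2; under eq_fun do rewrite expr2; apply: cvgM.
  apply: cvgB; first by apply: cvgD => //; exact: cvg_cst.
  by apply: cvg_norm; apply: cvgB => //; exact: cvg_cst.
move=> /cvgrPdist_lt /(_ (e / 2)); rewrite divr_gt0// => /(_ isT)[n _ /(_ n (leqnn _))].
rewrite /= ltr_norml => /andP[_ h]; exists n.
have h1 : (\int[mu]_x trunc_sqr m (grid_proj n f) x <= nrm (grid_proj n f) ^+ 2)%R.
  rewrite sqrE; apply: le_Rint; [apply: i_trunc; exact: inL2_grid_proj|exact/inL2_sqr/inL2_grid_proj|].
  by move=> x; rewrite (le_trans (ler_norm _))//; exact: trunc_sqr_le.
lra.
Unshelve. all: end_near. Qed.

End cell_averages.

(** * From step functions to test functions *)

Section density.
Context {R : realType}.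
Local Notation mu := (@lebesgue_measure R).
Implicit Types (f g phi : R -> R) (a b c x : R).

Definition test_approx f :=
  forall e, 0 < e -> exists2 phi, test_function phi & nrm (fun x => f x - phi x) < e.

Lemma test_approxZ c f : inL2 f -> test_approx f -> test_approx (fun x => c * f x).
Proof.
move=> hf af e e0.
have c0 : 0 < 1 + `|c| by rewrite ltr_wpDr.
have [phi tp H] := af (e / (1 + `|c|)) (divr_gt0 e0 c0).
exists (fun x => c * phi x); first exact: testZ.
have h2 := inL2B hf (test_L2 tp).
have -> : (fun x => c * f x - c * phi x) = (fun x => c * (f x - phi x)).
  by apply/funext => x; ring.
rewrite nrmZ//; move: H; rewrite ltr_pdivlMr// => H.
by have := nrm_ge0 (fun x => f x - phi x); nra.
Qed.

Lemma test_approxD f g : inL2 f -> inL2 g -> test_approx f -> test_approx g ->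
  test_approx (fun x => f x + g x).
Proof.
move=> hf hg af ag e e0; have e2 : 0 < e / 2 by rewrite divr_gt0.
have [phi tp H] := af _ e2; have [psi ts H'] := ag _ e2.
exists (fun x => phi x + psi x); first exact: testD.
have h := nrmD (inL2B hf (test_L2 tp)) (inL2B hg (test_L2 ts)).
have -> : (fun x => f x + g x - (phi x + psi x)) = (fun x => f x - phi x + (g x - psi x)).
  by apply/funext => x; ring.
lra.
Qed.

Lemma test_approx_sum (N : nat) (c : nat -> R) (e : nat -> R -> R) :
  (forall i, inL2 (e i)) -> (forall i, test_approx (e i)) ->
  test_approx (fun x => \sum_(i < N) c i * e i x).
Proof.
move=> he ae; elim: N => [|N IH].
  have -> : (fun x => \sum_(i < 0) c i * e i x) = (fun x => 0 * e 0%N x).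
    by apply/funext => x; rewrite big_ord0 mul0r.
  exact: test_approxZ.
have -> : (fun x => \sum_(i < N.+1) c i * e i x) =
    (fun x => (\sum_(i < N) c i * e i x) + c N * e N x).
  by apply/funext => x; rewrite big_ord_recr.
apply: test_approxD => //; [exact: inL2_sum|exact: inL2Z|exact: test_approxZ].
Qed.

(** Smoothed indicators with transition layers of width 1/(n+1) inside the interval. All of them are
    bounded by 1 and supported in one compact set, so dominated convergence applies to the squared
    difference. *)
Lemma test_approx_itv a b : test_approx (\1_(`[a, b[%classic : set R)).
Proof.
move=> e e0; pose A : set R := `[a, b[%classic.
pose phi (n : nat) x := step (n.+1%:R * x + - (n.+1%:R * a)) * step (- n.+1%:R * x + n.+1%:R * b).
have phiE n x : phi n x = step (n.+1%:R * (x - a)) * step (n.+1%:R * (b - x)).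
  by rewrite /phi; congr (step _ * step _); ring.
have n0 n : 0 < n.+1%:R :> R by rewrite ltr0n.
pose K := 1 + `|a| + `|b|.
have out n x : ~~ (a < x < b) -> phi n x = 0.
  rewrite phiE negb_and -!leNgt => /orP[h|h].
    by rewrite step_le0 ?mul0r// pmulr_rle0// subr_le0.
  by rewrite [X in _ * X]step_le0 ?mulr0// pmulr_rle0// subr_le0.
have K0 x : K < `|x| -> ~~ (a < x < b).
  move=> h; apply/negP => /andP[h1 h2]; move: h; rewrite /K ltNge ler_norml.
  have := ler_norm b; have := ler_norm (- a); rewrite normrN.
  by have := normr_ge0 a; have := normr_ge0 b; lra.
have phi01 n x : 0 <= phi n x <= 1.
  rewrite phiE; have /andP[h1 h2] := step_itv (n.+1%:R * (x - a)).
  have /andP[h3 h4] := step_itv (n.+1%:R * (b - x)).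
  by rewrite mulr_ge0// mulr_ile1.
have tphi n : test_function (phi n).
  apply: (@test_functionI _ _ K); last by move=> x /K0/out.
  by apply: smoothM; apply: smooth_affine; exact: smooth_step.
have mA : measurable_fun setT (\1_A : R -> R) by apply: measurable_indic; exact: measurable_itv.
have : (\int[mu]_x ((\1_A x - phi n x) ^+ 2))%R @[n --> \oo] --> (\int[mu]_x (0 : R))%R.
  apply: (@Rint_cvg R (fun n x => (\1_A x - phi n x) ^+ 2) (fun=> 0)
  (fun x => 1 * \1_`[- K, K] x) _ _ _ _ _).2.
- move=> n; apply: measurable_funX; apply: measurable_funB => //.
  exact: (test_measurable (tphi n)).
- exact: measurable_cst.
- by apply: inL1Z; exact: inL1_itv.
- move=> n x; rewrite ger0_norm ?sqr_ge0// mul1r.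
  have [xK|Kx] := leP `|x| K.
    rewrite [leRHS]indicE mem_set; last by rewrite /= in_itv/= -ler_norml.
    have /andP[h1 h2] := phi01 n x.
    have : 0 <= (\1_A x : R) <= 1 by rewrite indicE; case: (_ \in _); rewrite !lexx ler01.
    by move=> /andP[h3 h4] /=; rewrite expr2; nra.
  rewrite out ?K0// indicE memNset ?subr0 ?expr0n//=.
  rewrite /A/= in_itv/= => /andP[h1 h2]; move: Kx; rewrite /K ltNge ler_norml.
  have := ler_norm b; have := ler_norm (- a); rewrite normrN.
  by have := normr_ge0 a; have := normr_ge0 b; lra.
(* The pointwise limit is the indicator of ]a, b[, which can differ from that of [a, b[ only at
   [a]. *)
- exists [set a]; split; [exact: measurable_set1|exact: lebesgue_measure_set1|].
  move=> x /= H; apply: contrapT => xa; apply: H.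
  apply: cvg_near_cst; near=> n.
  have [/andP[h1 h2]|h] := boolP (a < x < b).
    rewrite indicE mem_set /=; last by rewrite /A/= in_itv/= (ltW h1).
    rewrite phiE !step_ge1 ?mulr1 ?subrr ?expr0n//.
      rewrite -ler_pdivrMr ?subr_gt0// mul1r (@le_trans _ _ n%:R)//; last by rewrite ler_nat.
      by near: n; exact: nbhs_infty_ger.
    rewrite -ler_pdivrMr ?subr_gt0// mul1r (@le_trans _ _ n%:R)//; last by rewrite ler_nat.
    by near: n; exact: nbhs_infty_ger.
  rewrite out// indicE memNset /= ?subr0 ?expr0n// /A/= in_itv/= => /andP[h1 h2].
  by move: h; rewrite h2 andbT lt_neqAle h1 andbT => /negPn/eqP; exact: nesym.
have -> : (\int[mu]_x (0 : R) = 0)%R by rewrite /Rintegral integral0.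
move=> /cvgrPdist_lt/(_ (e ^+ 2)); rewrite exprn_gt0// => /(_ isT)[n _ /(_ n (leqnn _))].
rewrite /= sub0r normrN => H; exists (phi n) => //.
rewrite -(@ltr_pXn2r _ 2) ?nnegrE ?(ltW e0)// nrm_sqr (le_lt_trans _ H)//.
rewrite (le_trans _ (ler_norm _))//.
Unshelve. all: end_near. Qed.

(** A grid projection close to [f] is a finite combination of indicators of intervals, each of which
    is approximated by test functions. The loss (e/2)^2 is measured on squared norms, so by
    Pythagoras the projection is within e/2 of [f]. *)
Theorem test_dense f : inL2 f -> test_approx f.
Proof.
move=> hf e e0; have e4 : 0 < (e / 2) ^+ 2 by rewrite exprn_gt0// divr_gt0.
have [n Hn] := nrm_grid_proj_lim hf e4.
have ap : test_approx (grid_proj n f).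
  apply: (@test_approx_sum _ (fun k => n.+1%:R * pairing (\1_(gcell n k)) f) (fun k => \1_(gcell n k))) => i.
    exact: inL2_cell.
  exact: test_approx_itv.
have [phi tp H] := ap (e / 2) (divr_gt0 e0 (ltr0Sn _ 1)).
exists phi => //.
have hp := inL2_grid_proj n f.
apply: le_lt_trans (nrm_triangle hf hp (test_L2 tp)) _.
have : nrm (fun x => f x - grid_proj n f x) < e / 2.
  rewrite -(@ltr_pXn2r _ 2) ?nnegrE ?divr_ge0 ?(ltW e0)//.
  by rewrite grid_proj_pyth//; lra.
lra.
Qed.

End density.

(** * Transport equations *)

Section strong_derivatives.
Context {R : realType}.
Local Notation mu := (@lebesgue_measure R).
Implicit Types (f g phi psi : R -> R) (a b c x y t s : R).

(** Test the inequality on a test function close to [g] itself. *)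
Lemma nrm_le_dual g C : inL2 g -> 0 <= C ->
  (forall phi, test_function phi -> `|pairing g phi| <= C * nrm phi) -> nrm g <= C.
Proof.
move=> hg C0 H; rewrite leNgt; apply/negP => Cg.
(* For phi within [e] of [g], the squared norm of [g] is at most |g| e + C (|g| + e), where |g| is
   the norm. This [e] solves e (|g| + C + 1) = |g| (|g| - C), which makes that bound smaller than
   |g|^2 by exactly [e]. *)
pose e := nrm g * (nrm g - C) / (nrm g + C + 1).
have g0 : 0 < nrm g by apply: le_lt_trans Cg.
have d0 : 0 < nrm g + C + 1 by rewrite ltr_wpDl// addr_ge0.
have e0 : 0 < e by rewrite divr_gt0// mulr_gt0// subr_gt0.
have [phi tp Hp] := test_dense hg e0; have hp := test_L2 tp.
have h1 : nrm g ^+ 2 = pairing g (fun x => g x - phi x) + pairing g phi.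
  by rewrite nrm_sqr pairingBr//; ring.
have := pairing_CS hg (inL2B hg hp); have := H _ tp.
rewrite !ler_norml => /andP[_ h2] /andP[_ h3].
have h4 : nrm phi <= nrm g + nrm (fun x => g x - phi x).
  rewrite (_ : nrm phi = nrm (fun x => g x - (g x - phi x))); last first.
    by congr nrm; apply/funext => x; ring.
  by apply: nrmB => //; exact: inL2B.
have h5 : nrm g * nrm (fun x => g x - phi x) <= nrm g * e by rewrite ler_wpM2l// ltW.
have h6 : C * nrm phi <= C * (nrm g + e).
  by rewrite ler_wpM2l// (le_trans h4)// lerD2l ltW.
have h7 : e * (nrm g + C + 1) = nrm g * (nrm g - C) by rewrite /e divfK// gt_eqF.
nra.
Qed.

Lemma nrm_eq0_dual g : inL2 g ->
  (forall phi, test_function phi -> pairing g phi = 0) -> nrm g = 0.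
Proof.
move=> hg H; apply/eqP; rewrite eq_le nrm_ge0 andbT; apply: nrm_le_dual => // phi tp.
by rewrite H// normr0 mul0r.
Qed.

(** Mean value theorem with endpoints in either order, for increments [h] of both signs. Only the
    distance of the intermediate point to [x] is recorded, which is all that limits as h tends to 0
    require. *)
Lemma MVT_sym (f df : R -> R) x y :
  (forall z, `|z - x| <= `|y - x| -> is_derive z (1 : R) f (df z)) ->
  exists2 c, `|c - x| <= `|y - x| & f y - f x = df c * (y - x).
Proof.
move=> H.
have cont a b : (forall z, z \in `[a, b] -> `|z - x| <= `|y - x|) ->
    {within `[a, b], continuous f}.
  move=> Hz; apply: derivable_within_continuous => z zab.
  by have [] := H z (Hz z zab).
have [xy|xy] := leP x y.
  have Hz z : z \in `[x, y] -> `|z - x| <= `|y - x|.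
    by rewrite in_itv/= => /andP[h1 h2]; rewrite !ger0_norm ?subr_ge0// lerD2r.
  have [|c cxy ->] := @MVT_segment _ f df _ _ xy _ (cont _ _ Hz).
    by move=> z zxy; apply: H; apply: Hz; apply: subset_itv_oo_cc.
  by exists c => //; exact: Hz.
have Hz z : z \in `[y, x] -> `|z - x| <= `|y - x|.
  rewrite in_itv/= => /andP[h1 h2]; rewrite !ler0_norm ?subr_le0 ?(ltW xy)//.
  by rewrite lerN2 lerD2r.
have [|c cxy E] := @MVT_segment _ f df _ _ (ltW xy) _ (cont _ _ Hz).
  by move=> z zxy; apply: H; apply: Hz; apply: subset_itv_oo_cc.
by exists c; [exact: Hz|lra].
Qed.

Lemma smooth_lipschitz f L : smooth f -> (forall x, `|derive1 f x| <= L) ->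
  forall x y, `|f y - f x| <= L * `|y - x|.
Proof.
move=> sf HL x y.
have [c _ ->] := @MVT_sym f (derive1 f) x y (fun z _ => smooth_is_derive z sf).
by rewrite normrM ler_wpM2r.
Qed.

(** The mean value theorem for phi, then the Lipschitz bound for its derivative, give a pointwise
    error of at most L c^2 |h| on a support of fixed size. *)
Lemma test_diff_quot c phi : test_function phi ->
  nrm (fun x => h^-1 * (tau (c * h) phi x - phi x) - c * derive1 phi x)
    @[h --> 0^'] --> 0.
Proof.
move=> tp; have tp' := test_derive1 tp; have tp'' := test_derive1 tp'.
have [K K0 HK] := test_support tp; have [K' K'0 HK'] := test_support tp'.
have [L L0 HL] := test_bounded tp''.
(* Beyond [S] the function, its derivative and, for |h| <= 1, the translate by c h all vanish. *)
pose S := K + K' + `|c|; have S0 : 0 <= S by rewrite !addr_ge0// ltW.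
apply: (@squeeze_cvgr _ _ _ _ (fun=> 0) (fun h => (L * c ^+ 2 * `|h|) * Num.sqrt (S *+ 2))).
- near=> h; rewrite nrm_ge0/=.
  have h0 : h != 0 by near: h; exact: nbhs_dnbhs_neq.
  have h1 : `|h| <= 1.
    by near: h; exact: dnbhs0_le.
  apply: (bdd_support_L2 _ S0 _ _ _).2.
  + apply: measurable_funB; last by apply: measurable_funM => //; exact: test_measurable.
    apply: measurable_funM => //; apply: measurable_funB; last exact: test_measurable.
    by apply: measurable_tau; exact: test_measurable.
  + by apply: mulr_ge0 => //; apply: mulr_ge0; [exact: ltW|exact: sqr_ge0].
  + move=> x.
    have [z zx ->] := @MVT_sym phi (derive1 phi) x (x + c * h)
      (fun z _ => smooth_is_derive z (test_smooth tp)).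
    rewrite addrAC subrr add0r in zx *.
    have -> : h^-1 * (derive1 phi z * (c * h)) - c * derive1 phi x =
        c * (derive1 phi z - derive1 phi x) by field.
    rewrite normrM.
    have := smooth_lipschitz (test_smooth tp') HL x z => H.
    have : `|derive1 phi z - derive1 phi x| <= L * (`|c| * `|h|).
      by rewrite (le_trans H)// ler_pM2l// -normrM.
    move=> /(ler_wpM2l (normr_ge0 c)) /le_trans; apply.
    by rewrite -[c ^+ 2]real_normK ?num_real// le_eqVlt; apply/orP; left; apply/eqP; ring.
  + move=> x Sx; rewrite /tau.
    have ch : `|c * h| <= `|c| by rewrite normrM ler_piMr.
    have := normr_ge0 c; rewrite /S in Sx => c0.
    rewrite (HK x); last by lra.
    rewrite (HK' x); last by lra.
    rewrite HK ?subrr ?mulr0 ?subrr//.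
    by have := ler_normB (x + c * h) (c * h); rewrite addrK; lra.
- exact: cvg_cst.
- rewrite [X in _ --> X](_ : _ = (L * c ^+ 2 * 0) * Num.sqrt (S *+ 2)); last by ring.
  apply: cvgM; last exact: cvg_cst.
  by apply: cvgM; [exact: cvg_cst|apply/norm_cvg0P; exact: cvg_within].
Unshelve. all: end_near. Qed.

(** Test functions are Lipschitz with bounded support, so the claim is direct for them; the general
    case follows by density because translations preserve the norm. *)
Lemma tau_cvg0 f : inL2 f -> nrm (fun x => tau h f x - f x) @[h --> 0] --> 0.
Proof.
move=> hf; apply/cvgr0Pnorm_le => e e0.
have e3 : 0 < e / 3 by rewrite divr_gt0.
have [phi tp Hp] := test_dense hf e3; have hp := test_L2 tp.
have [K K0 HK] := test_support tp; have [L L0 HL] := test_bounded (test_derive1 tp).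
pose S := Num.sqrt ((K + 1) *+ 2).
apply/nbhs_ballP; exists (Num.min 1 (e / 3 / (L * (S + 1)))) => /=.
  by rewrite lt_min ltr01 divr_gt0// mulr_gt0// ltr_wpDl// sqrtr_ge0.
move=> h; rewrite /ball/= sub0r normrN lt_min => /andP[/ltW h1 /ltW h2].
have S0 : 0 <= S by exact: sqrtr_ge0.
have K1 : 0 <= K + 1 by lra.
have tphi := test_tau h tp.
have h3 : nrm (fun x => tau h phi x - phi x) <= e / 3.
  apply: le_trans (@bdd_support_L2 _ _ (K + 1) (L * `|h|) _ K1 _ _ _).2 _.
  - by apply: measurable_funB; exact: test_measurable.
  - by rewrite mulr_ge0// ltW.
  - move=> x; rewrite (le_trans (smooth_lipschitz (test_smooth tp) HL _ _))//.
    by rewrite addrAC subrr add0r.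
  - move=> x Kx; rewrite /tau (HK x); last by lra.
    rewrite HK ?subrr//.
    by have := ler_normB (x + h) h; rewrite addrK; lra.
  rewrite -/S; move: h2; rewrite ler_pdivlMr ?mulr_gt0// ?ltr_wpDl// => h2.
  have : 0 <= L * `|h| by rewrite mulr_ge0// ltW.
  nra.
have hh := inL2_tau h hf; have ht := test_L2 tphi.
rewrite ger0_norm; last exact: nrm_ge0.
have t1 := nrm_triangle hh ht hf; have t2 := nrm_triangle ht hp hf.
have : nrm (fun x => tau h f x - tau h phi x) = nrm (fun x => f x - phi x).
  exact: (nrm_tau h (inL2B hf hp)).
rewrite (nrm_subC phi) in t2; lra.
Qed.

Definition curve (w : R -> R -> R) := (forall t, inL2 (w t)) /\
  forall t0, nrm (fun x => w t x - w t0 x) @[t --> t0] --> 0.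

Lemma curve_shift (w : R -> R -> R) t : curve w ->
  nrm (fun x => w (t + h) x - w t x) @[h --> 0^'] --> 0.
Proof.
move=> [_ /(_ t) cw]; apply: (@cvg_comp _ _ _ (fun h : R => t + h) (fun r => nrm (fun x => w r x - w t x)) _ (nbhs t)) cw.
have H : t + h @[h --> 0^'] --> t + 0 by apply: cvgD; [exact: cvg_cst|exact: cvg_within].
by rewrite addr0 in H.
Qed.

(** Translations are only strongly continuous, so the difference is split: a common shift applied to
    [F t - F t0], and a change of shift applied to the fixed function [F t0]. *)
Lemma curve_tau s (F : R -> R -> R) : curve F -> curve (fun t => tau (s * t) (F t)).
Proof.
move=> [FL Fc]; split=> [t|t0]; first exact: inL2_tau.
apply: (@squeeze_cvgr _ _ _ _ (fun=> 0) (fun t => nrm (fun x => F t x - F t0 x) +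
   nrm (fun x => tau (s * (t - t0)) (F t0) x - F t0 x))).
- near=> t; rewrite nrm_ge0/=.
  apply: le_trans (nrm_triangle (inL2_tau (s * t) (FL t)) (inL2_tau (s * t) (FL t0)) (inL2_tau (s * t0) (FL t0))) _.
  apply: lerD; rewrite le_eqVlt; apply/orP; left; apply/eqP.
    exact: (nrm_tau (s * t) (inL2B (FL t) (FL t0))).
  rewrite -[RHS](nrm_tau (s * t0)); last by apply: inL2B => //; exact: inL2_tau.
  congr nrm; apply/funext => x; rewrite /tau; congr (F t0 _ - _); ring.
- exact: cvg_cst.
- rewrite -[X in _ --> X]addr0; apply: cvgD; first exact: Fc.
  apply: (@cvg_comp _ _ _ (fun t : R => s * (t - t0)) (fun h => nrm (fun x => tau h (F t0) x - F t0 x)) _ (nbhs 0)); last exact: tau_cvg0.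
  have H : s * (t - t0) @[t --> t0] --> s * (t0 - t0).
    apply: cvgM; first exact: cvg_cst.
    by apply: cvgB; [exact: cvg_id|exact: cvg_cst].
  by rewrite subrr mulr0 in H.
Unshelve. all: end_near. Qed.

(* Weak form of w_t + s w_x = F, for t > 0. *)
Definition transport s (w F : R -> R -> R) := [/\ curve w, curve F &
  forall phi, test_function phi -> forall t, 0 < t ->
    is_derive t (1 : R) (fun r => pairing (w r) phi)
      (s * pairing (w t) (derive1 phi) + pairing (F t) phi)].

(** The shift is moved to the test function, whose time derivative [- s * derive1 psi] cancels the
    term s w_x. *)
Lemma transport_moving s w F phi t : transport s w F -> test_function phi -> 0 < t ->
  is_derive t (1 : R) (fun r => pairing (tau (s * r) (w r)) phi)
    (pairing (tau (s * t) (F t)) phi).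
Proof.
move=> [cw [FL _] H] tp t0; have [wL _] := cw.
apply: is_deriveI; pose psi := tau (- (s * t)) phi.
have tpsi : test_function psi by exact: test_tau.
have hpsi := test_L2 tpsi.
have E h : pairing (tau (s * (t + h)) (w (t + h))) phi =
    pairing (w (t + h)) (tau (- s * h) psi).
  rewrite pairing_tauN//; last exact: test_L2.
  by congr pairing; rewrite /psi tauD; congr (tau _ phi); ring.
have -> : pairing (tau (s * t) (F t)) phi = (s * pairing (w t) (derive1 psi) +
    pairing (F t) psi) + pairing (w t) (fun x => - s * derive1 psi x).
  rewrite pairing_tauN//; last exact: test_L2.
  by rewrite pairingZr//; [ring|exact/test_L2/test_derive1].
have -> : (fun h => h^-1 * (pairing (tau (s * (t + h)) (w (t + h))) phi
      - pairing (tau (s * t) (w t)) phi)) =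
    (fun h => h^-1 * (pairing (w (t + h)) psi - pairing (w t) psi) +
      pairing (w (t + h)) (fun x => h^-1 * (tau (- s * h) psi x - psi x))).
  apply/funext => h; rewrite E pairing_tauN//; last exact: test_L2.
  have ht := inL2_tau (- s * h) hpsi.
  rewrite pairingZr//; last exact: inL2B.
  by rewrite pairingBr// -/psi; ring.
apply: cvgD; first exact: (is_derive_quot (H _ tpsi _ t0)).
apply: pairing_cvg => //.
- by move=> h; apply: inL2Z; apply: inL2B => //; exact: inL2_tau.
- by apply: inL2Z; exact/test_L2/test_derive1.
- exact: curve_shift.
- exact: test_diff_quot.
Qed.

(* By [transport_moving], t |-> w(t, . + st) has a norm continuous weak derivative;
   the mean value theorem against each test function, uniform in the test function,
   then turns it into a strong derivative. *)
Lemma transport_strong s w F t : transport s w F -> 0 < t ->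
  nrm (fun x => h^-1 * (tau (s * (t + h)) (w (t + h)) x - tau (s * t) (w t) x)
    - tau (s * t) (F t) x) @[h --> 0^'] --> 0.
Proof.
move=> tr t0; have [[wL cw] cF _] := tr.
have [GL cG] := curve_tau s cF; set G := (fun r => tau (s * r) (F r)) in GL cG.
have WL r : inL2 (tau (s * r) (w r)) by exact: inL2_tau.
set W := (fun r => tau (s * r) (w r)) in WL.
apply/cvgr0Pnorm_le => e e0.
have /cvgr0Pnorm_le /(_ _ e0) /nbhs_ballP[d /= d0 Hd] := cG t.
near=> h; rewrite ger0_norm; last exact: nrm_ge0.
have h0 : h != 0 by near: h; exact: nbhs_dnbhs_neq.
(* Below [d] the source varies by at most [e]; below [t] all intermediate times stay positive, where
   the equation holds. *)
have hd : `|h| < Num.min d t.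
  by near: h; apply: dnbhs0_lt; rewrite lt_min d0.
move: hd; rewrite lt_min => /andP[hd ht].
have hW : inL2 (fun x => W (t + h) x - W t x) by apply: inL2B; exact: WL.
have -> : (fun x => h^-1 * (W (t + h) x - W t x) - G t x) =
    (fun x => h^-1 * ((W (t + h) x - W t x) - h * G t x)).
  by apply/funext => x; rewrite [RHS]mulrBr mulKf.
have hD : inL2 (fun x => (W (t + h) x - W t x) - h * G t x).
  by apply: inL2B => //; apply: inL2Z; exact: GL.
rewrite nrmZ// normfV ler_pdivrMl ?normr_gt0//.
apply: nrm_le_dual => //; first by rewrite mulr_ge0// ltW.
move=> phi tp; have hp := test_L2 tp.
have hG := GL t; have hhG := inL2Z h hG.
rewrite (pairingBl hW hhG hp) (pairingBl (WL _) (WL _) hp) (pairingZl h hG hp).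
have [|c ct E] := @MVT_sym (fun r => pairing (W r) phi) (fun r => pairing (G r) phi) t (t + h).
  move=> z; rewrite addrAC subrr add0r => zh.
  apply: transport_moving => //.
  by have := ler_norm (t - z); rewrite distrC; lra.
rewrite addrAC subrr add0r in ct E; rewrite E.
have -> : pairing (G c) phi * h - h * pairing (G t) phi =
    h * pairing (fun x => G c x - G t x) phi.
  by rewrite (pairingBl (GL c) hG hp); ring.
rewrite normrM -mulrA ler_wpM2l//.
rewrite (le_trans (pairing_CS (inL2B (GL c) (GL t)) hp))// ler_wpM2r ?nrm_ge0//.
have := Hd c; rewrite ger0_norm; last exact: nrm_ge0.
apply.
by rewrite /ball/= distrC (le_lt_trans ct).
Unshelve. all: end_near. Qed.

(** As both speeds are equal, shifting both curves by s t leaves the pairing unchanged. The shifted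
    curves are strongly differentiable, so the ordinary product rule applies. *)
Lemma transport_pairing s w1 F1 w2 F2 t :
  transport s w1 F1 -> transport s w2 F2 -> 0 < t ->
  is_derive t (1 : R) (fun r => pairing (w1 r) (w2 r))
    (pairing (F1 t) (w2 t) + pairing (w1 t) (F2 t)).
Proof.
move=> tr1 tr2 t0; have [c1 [F1L _] _] := tr1; have [c2 [F2L _] _] := tr2.
have [w1L _] := c1; have [w2L _] := c2.
have [W1L cW1] := curve_tau s c1; have cc2 := curve_tau s c2; have [W2L cW2] := cc2.
set W1 := (fun r => tau (s * r) (w1 r)) in W1L cW1.
set W2 := (fun r => tau (s * r) (w2 r)) in W2L cW2.
have E r : pairing (w1 r) (w2 r) = pairing (W1 r) (W2 r) by rewrite pairing_tau.
apply: is_deriveI.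
have -> : pairing (F1 t) (w2 t) + pairing (w1 t) (F2 t) =
    pairing (tau (s * t) (F1 t)) (W2 t) + pairing (W1 t) (tau (s * t) (F2 t)).
  by rewrite !pairing_tau.
have -> : (fun h => h^-1 * (pairing (w1 (t + h)) (w2 (t + h)) - pairing (w1 t) (w2 t))) =
   (fun h => pairing (fun x => h^-1 * (W1 (t + h) x - W1 t x)) (W2 (t + h)) +
      pairing (W1 t) (fun x => h^-1 * (W2 (t + h) x - W2 t x))).
  apply/funext => h; rewrite !E.
  rewrite pairingZl; [|exact: (inL2B (W1L _) (W1L _))|exact: W2L].
  rewrite pairingZr; [|exact: (inL2B (W2L _) (W2L _))|exact: W1L].
  rewrite (pairingBl (W1L _) (W1L _) (W2L _)) (pairingBr (W2L _) (W2L _) (W1L _)).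
  ring.
apply: cvgD; apply: pairing_cvg => //; try exact: inL2_tau.
- by move=> h; apply: inL2Z; exact: (inL2B (W1L _) (W1L _)).
- by move=> h; exact: W2L.
- exact: transport_strong.
- exact: (curve_shift t cc2).
- by move=> _; exact: W1L.
- by move=> h; apply: inL2Z; exact: (inL2B (W2L _) (W2L _)).
- have -> : (fun=> nrm (fun x => W1 t x - W1 t x)) = (fun _ : R => 0 : R).
    apply/funext => h; rewrite /nrm /pairing (@eq_Rint _ _ (fun=> 0)).
      by rewrite /Rintegral integral0 sqrtr0.
    by move=> x; rewrite subrr mul0r.
  exact: cvg_cst.
- exact: transport_strong.
Qed.

End strong_derivatives.

(** * Weak derivatives and the Sobolev inequality *)

Section weak_derivatives.
Context {R : realType}.
Local Notation mu := (@lebesgue_measure R).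
Implicit Types (f g phi psi : R -> R) (a b c x y t s : R).

Lemma curve_cst f : inL2 f -> curve (fun=> f).
Proof.
move=> hf; split=> // t0; have -> : nrm (fun x => f x - f x) = 0.
  rewrite /nrm /pairing (@eq_Rint _ _ (fun=> 0)).
    by rewrite /Rintegral integral0 sqrtr0.
  by move=> x; rewrite subrr mul0r.
exact: cvg_cst.
Qed.

Lemma curveD (w z : R -> R -> R) : curve w -> curve z ->
  curve (fun t x => w t x + z t x).
Proof.
move=> [wL cw] [zL cz]; split=> [t|t0]; first exact: inL2D.
apply: (@squeeze_cvgr _ _ _ _ (fun=> 0) (fun t => nrm (fun x => w t x - w t0 x) +
   nrm (fun x => z t x - z t0 x))).
- near=> t; rewrite nrm_ge0/=.
  apply: le_trans (nrmD (inL2B (wL t) (wL t0)) (inL2B (zL t) (zL t0))).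
  by rewrite le_eqVlt; apply/orP; left; apply/eqP; congr nrm; apply/funext => x; ring.
- exact: cvg_cst.
- by rewrite -[X in _ --> X]addr0; apply: cvgD.
Unshelve. all: end_near. Qed.

Lemma curve_bddM (w : R -> R -> R) g M : measurable_fun setT g ->
  (forall x, `|g x| <= M) -> curve w -> curve (fun t x => g x * w t x).
Proof.
move=> mg gM [wL cw]; split=> [t|t0]; first exact: inL2_bddM (gM) _.
apply: (@squeeze_cvgr _ _ _ _ (fun=> 0) (fun t => M * nrm (fun x => w t x - w t0 x))).
- near=> t; rewrite nrm_ge0/=.
  apply: le_trans (nrm_bddM mg gM (inL2B (wL t) (wL t0))).
  by rewrite le_eqVlt; apply/orP; left; apply/eqP; congr nrm; apply/funext => x; ring.
- exact: cvg_cst.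
- by rewrite -[X in _ --> X](mulr0 M); apply: cvgM => //; exact: cvg_cst.
Unshelve. all: end_near. Qed.

Lemma curveZ c (w : R -> R -> R) : curve w -> curve (fun t x => c * w t x).
Proof. exact: (@curve_bddM _ (fun=> c) `|c|). Qed.

Lemma transport_weight s (w F : R -> R -> R) chi : transport s w F ->
  test_function chi ->
  transport s (fun t x => chi x * w t x)
    (fun t x => chi x * F t x + s * (derive1 chi x * w t x)).
Proof.
move=> [cw cF H] tc; have tc' := test_derive1 tc.
have [M M0 HM] := test_bounded tc; have [L L0 HL] := test_bounded tc'.
have mc := test_measurable tc; have mc' := test_measurable tc'.
split.
- exact: curve_bddM cw.
- apply: curveD; first exact: curve_bddM cF.
  by apply: curveZ; exact: curve_bddM cw.
move=> phi tp t t0; have sc := test_smooth tc; have sp := test_smooth tp.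
have [wL _] := cw; have [FL _] := cF; have hp := test_L2 tp.
have tcp : test_function (fun x => chi x * phi x) by exact: testM.
have := H _ tcp t t0; apply: is_derive_ext.
  by move=> r; apply: eq_Rint => x; ring.
have -> : derive1 (fun x => chi x * phi x) =
    (fun x => chi x * derive1 phi x + derive1 chi x * phi x).
  apply/funext => x; apply: is_derive_derive1.
  have := is_deriveM (smooth_is_derive x sc) (smooth_is_derive x sp).
  apply: is_derive_ext => //; rewrite -[_ *: _]/(_ * _) -[X in _ + X]/(_ * _); ring.
have tp' := test_derive1 tp.
have h1 : inL2 (fun x => chi x * derive1 phi x) by apply/test_L2/testM.
have h2 : inL2 (fun x => derive1 chi x * phi x).
  by apply/test_L2/testM => //; exact: test_smooth.
have h3 : inL2 (fun x => chi x * F t x) by exact: inL2_bddM HM _.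
have h4 : inL2 (fun x => derive1 chi x * w t x) by exact: inL2_bddM HL _.
rewrite pairingDr// pairingDl//; last exact: inL2Z.
rewrite pairingZl//.
have -> : pairing (w t) (fun x => chi x * derive1 phi x) =
    pairing (fun x => chi x * w t x) (derive1 phi) by apply: eq_Rint => x; ring.
have -> : pairing (w t) (fun x => derive1 chi x * phi x) =
    pairing (fun x => derive1 chi x * w t x) phi by apply: eq_Rint => x; ring.
have -> : pairing (F t) (fun x => chi x * phi x) =
    pairing (fun x => chi x * F t x) phi by apply: eq_Rint => x; ring.
ring.
Qed.

(** A function constant in time solves w_t + s w_x = s f'. In this way results on transport become
    results on weak derivatives. *)
Lemma weak_transport s f g : inL2 f -> inL2 g -> is_weak_derivative f g ->
  transport s (fun=> f) (fun _ x => s * g x).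
Proof.
move=> hf hg H; split; [exact: curve_cst|by apply/curve_cst/inL2Z|].
move=> phi tp t t0; have hp := test_L2 tp.
have -> : s * pairing f (derive1 phi) + pairing (fun x => s * g x) phi = 0.
  by rewrite H// pairingZl//; ring.
exact: is_derive_const.
Qed.

(** In the moving frame at speed 1, the constant curve [f] becomes the family of its translates, and
    strong differentiability in time is differentiability along translations. Time 1 is an arbitrary
    positive time, undone by a shift. *)
Lemma weak_diff_quot f g : inL2 f -> inL2 g -> is_weak_derivative f g ->
  nrm (fun x => h^-1 * (tau h f x - f x) - g x) @[h --> 0^'] --> 0.
Proof.
move=> hf hg /(weak_transport 1 hf hg) /transport_strong /(_ ltr01).
move=> K; rewrite (_ : (fun h => nrm _) = (fun h : R => nrm (fun x =>
    h^-1 * (tau (1 * (1 + h)) f x - tau (1 * 1) f x) -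
    tau (1 * 1) (fun y => 1 * g y) x)))//.
apply/funext => h; have ht := inL2_tau h hf.
rewrite -[LHS](nrm_tau 1); last by apply: inL2B => //; apply: inL2Z; exact: inL2B.
by congr nrm; apply/funext => x; rewrite /tau !mul1r addrA.
Qed.

(* Differentiate the integral of f(x + h)^2 psi(x) at h = 0 in two ways: with the
   shift on f, or on psi. *)
Lemma weak_square_ibp f g psi (dpsi : R -> R) (M L : R) : inL2 f -> inL2 g -> is_weak_derivative f g ->
  measurable_fun setT psi -> measurable_fun setT dpsi ->
  (forall x, `|psi x| <= M) -> (forall x y, `|psi y - psi x| <= L * `|y - x|) ->
  (forall x, n.+1%:R * (psi (x + n.+1%:R^-1) - psi x) @[n --> \oo] --> dpsi x) ->
  (\int[mu]_x (dpsi x * f x ^+ 2) = - (2 * pairing (fun x => psi x * f x) g))%R.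
Proof.
move=> hf hg H mpsi mdpsi HM HL Hd.
have hpf : inL2 (fun x => psi x * f x) by exact: inL2_bddM HM _.
have hpg : inL2 (fun x => psi x * g x) by exact: inL2_bddM HM _.
have hd := weak_diff_quot hf hg H; have mf := inL2_meas hf.
have htf h := inL2_tau h hf.
have hq h : inL2 (fun x => h^-1 * (tau h f x - f x)) by apply/inL2Z/inL2B.
have hcont : nrm (fun x => tau h f x - f x) @[h --> 0^'] --> 0.
  by apply: cvg_within_filter; exact: tau_cvg0.
(* This is h^-1 times the integral of psi (f(. + h)^2 - f^2), factored as a difference of squares so
   that each factor converges in L2. *)
pose Q h := pairing (fun x => h^-1 * (tau h f x - f x)) (fun x => psi x * tau h f x)
  + pairing (fun x => psi x * f x) (fun x => h^-1 * (tau h f x - f x)).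
have Q1 : Q h @[h --> 0^'] --> pairing g (fun x => psi x * f x) + pairing (fun x => psi x * f x) g.
  apply: cvgD; apply: pairing_cvg => //.
  - by move=> h; exact: inL2_bddM HM _.
  - apply: (@squeeze_cvgr _ _ _ _ (fun=> 0) (fun h => M * nrm (fun x => tau h f x - f x))).
    + near=> h; rewrite nrm_ge0/=.
      apply: le_trans (nrm_bddM mpsi HM (inL2B (htf h) hf)).
      by rewrite le_eqVlt; apply/orP; left; apply/eqP; congr nrm; apply/funext => x; ring.
    + exact: cvg_cst.
    + by rewrite -[X in _ --> X](mulr0 M); apply: cvgM => //; exact: cvg_cst.
  - by case: (curve_cst hpf) => _ /(_ 0) K; apply: cvg_within_filter K.
have QE h : Q h = h^-1 * (\int[mu]_x ((tau (- h) psi x - psi x) * f x ^+ 2))%R.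
  have mt : measurable_fun setT (tau (- h) psi) by exact: measurable_tau.
  have ht : inL2 (fun x => psi x * tau h f x) by exact: inL2_bddM HM _.
  have hmf : inL2 (fun x => tau (- h) psi x * f x).
    by apply: (inL2_bddM mt _ hf) => x; exact: HM.
  have e1 : pairing (tau h f) (fun x => psi x * tau h f x) =
      (\int[mu]_x (tau (- h) psi x * f x * f x))%R.
    rewrite (pairing_tauN _ hf ht); apply: eq_Rint => x; rewrite /tau subrK; ring.
  rewrite /Q pairingZl ?pairingZr//; try exact: inL2B.
  rewrite pairingBl// pairingBr// e1 -mulrDr; congr (_ * _).
  have -> : (\int[mu]_x ((tau (- h) psi x - psi x) * f x ^+ 2) =
     \int[mu]_x (tau (- h) psi x * f x * f x - psi x * f x * f x))%R.
    by apply: eq_Rint => x; ring.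
  rewrite RintB; try exact: inL2_inL1M.
  rewrite -/(pairing (fun x => psi x * f x) f).
  have -> : pairing f (fun x => psi x * tau h f x) = pairing (fun x => psi x * f x) (tau h f).
    by apply: eq_Rint => x; ring.
  ring.
have L0 : 0 <= L by have := HL 0 1; rewrite subr0 normr1 mulr1; apply: le_trans.
(* Along h = -1/(n+1) the shift falls on [psi] as a forward quotient, dominated by [L] thanks to the
   Lipschitz bound. *)
have Q2 : Q (- n.+1%:R^-1) @[n --> \oo] --> - (\int[mu]_x (dpsi x * f x ^+ 2))%R.
  have K : (\int[mu]_x (n.+1%:R * (psi (x + n.+1%:R^-1) - psi x) * f x ^+ 2))%R @[n --> \oo]
      --> (\int[mu]_x (dpsi x * f x ^+ 2))%R.
    apply: (@Rint_cvg R (fun n x => n.+1%:R * (psi (x + n.+1%:R^-1) - psi x) * f x ^+ 2)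
    (fun x => dpsi x * f x ^+ 2) (fun x => L * f x ^+ 2) _ _ (inL1Z L (inL2_sqr hf)) _ _).2.
  - move=> n; apply: measurable_funM; last exact: (measurable_funX 2 mf).
    by apply: measurable_funM => //; apply: measurable_funB => //; exact: (measurable_tau _ mpsi).
  - by apply: measurable_funM => //; exact: (measurable_funX 2 mf).
  - move=> n x; rewrite normrM [`|f x ^+ 2|]ger0_norm ?sqr_ge0// ler_wpM2r ?sqr_ge0//.
    rewrite normrM ger0_norm// -ler_pdivlMl ?ltr0n// mulrC.
    rewrite (le_trans (HL _ _))// addrAC subrr add0r ger0_norm// invr_ge0//.
  - by apply: aeW => x; apply: cvgM; [exact: Hd|exact: cvg_cst].
  have -> : (fun n : nat => Q (- n.+1%:R^-1)) = (fun n : nat =>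
      - (\int[mu]_x (n.+1%:R * (psi (x + n.+1%:R^-1) - psi x) * f x ^+ 2))%R).
    apply/funext => n; rewrite QE opprK invrN invrK mulNr; congr (- _).
    rewrite -RintZ.
      by apply: eq_Rint => x; rewrite /tau; ring.
    apply: (@inL1_bddM _ _ _ (M + M)); last exact: inL2_sqr.
      by apply: measurable_funB => //; exact: (measurable_tau _ mpsi).
    by move=> x; exact: le_trans (ler_normB _ _) (lerD (HM _) (HM _)).
  exact: cvgN.
have Q3 : Q (- n.+1%:R^-1) @[n --> \oo] --> pairing g (fun x => psi x * f x) + pairing (fun x => psi x * f x) g.
  move/cvgr_dnbhsP: Q1; apply; split.
    by move=> n; rewrite oppr_eq0 invr_eq0 pnatr_eq0.
  by rewrite -oppr0; apply: cvgN; exact: cvg_harmonic.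
have := cvg_unique (@Rhausdorff R) Q2 Q3; rewrite (pairingC g) => E.
by apply: oppr_inj; rewrite opprK E; ring.
Unshelve. all: end_near. Qed.

Lemma weak_derivative_sqr f g phi : inL2 f -> inL2 g -> is_weak_derivative f g ->
  test_function phi ->
  pairing (fun x => f x ^+ 2) (derive1 phi) = - pairing (fun x => 2 * (f x * g x)) phi.
Proof.
move=> hf hg H tp; have tp' := test_derive1 tp.
have [M M0 HM] := test_bounded tp; have [L L0 HL] := test_bounded tp'.
have := @weak_square_ibp f g phi (derive1 phi) M L hf hg H (test_measurable tp)
  (test_measurable tp') HM.
have -> : pairing (fun x => f x ^+ 2) (derive1 phi) = (\int[mu]_x (derive1 phi x * f x ^+ 2))%R.
  by apply: eq_Rint => x; rewrite mulrC.
move=> ->.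
- have hpf : inL2 (fun x => phi x * f x) by apply: (inL2_bddM (test_measurable tp) HM hf).
  rewrite /pairing -RintZ; last exact: inL2_inL1M.
  by congr (- _); apply: eq_Rint => x; ring.
- exact: (smooth_lipschitz (test_smooth tp) HL).
- move=> x; have := is_derive_quot (smooth_is_derive x (test_smooth tp)).
  move=> /cvgr_dnbhsP/(_ (fun n => n.+1%:R^-1)).
  move=> K; rewrite (_ : (fun n : nat => _) = (fun n : nat =>
    n.+1%:R^-1^-1 * (phi (x + n.+1%:R^-1) - phi x))); last first.
    by apply/funext => n; rewrite invrK.
  by apply: K; split; [move=> n; rewrite invr_eq0 pnatr_eq0|exact: cvg_harmonic].
Qed.

(* [weak_square_ibp] for the ramp that has slope 1 on [a, b[ and is constant
   elsewhere. *)
Lemma ramp_sqr_le f g a b : inL2 f -> inL2 g -> is_weak_derivative f g -> a < b ->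
  (\int[mu]_x (\1_(`[a, b[%classic : set R) x * f x ^+ 2) <=
   (nrm f ^+ 2 + nrm g ^+ 2) * (b - a))%R.
Proof.
move=> hf hg H ab; have ba : 0 < b - a by rewrite subr_gt0.
pose psi x := Num.min (Num.max (x - a) 0) (b - a).
have psiE x : psi x = if x <= a then 0 else if x <= b then x - a else b - a.
  have h2 : 0 <= b - a by lra.
  rewrite /psi; case: (leP x a) => xa.
    have h1 : x - a <= 0 by lra.
    by rewrite (max_idPr h1) (min_idPl h2).
  have h1 : 0 <= x - a by lra.
  rewrite (max_idPl h1); case: (leP x b) => xb.
    have h3 : x - a <= b - a by lra.
    by rewrite (min_idPl h3).
  have h3 : b - a <= x - a by lra.
  by rewrite (min_idPr h3).
have mpsi : measurable_fun setT psi.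
  apply: measurable_minr => //; apply: measurable_maxr => //.
  exact: measurable_funB.
have psib x : `|psi x| <= b - a.
  rewrite psiE; case: ifPn => [_|]; first by rewrite normr0 ltW.
  rewrite -ltNge => xa; case: ifPn => xb; last by rewrite gtr0_norm.
  by rewrite gtr0_norm ?subr_gt0// lerD2r.
have psil x y : `|psi y - psi x| <= 1 * `|y - x|.
  wlog xy : x y / x <= y.
    move=> K; have [/K//|/ltW/K] := leP x y.
    by rewrite distrC [`|x - y|]distrC.
  rewrite mul1r [leRHS]ger0_norm ?subr_ge0// !psiE ler_norml.
  by case: (leP x a) => ?; case: (leP y a) => ?; case: (leP x b) => ?; case: (leP y b) => ?; lra.
have -> : (\int[mu]_x (\1_(`[a, b[%classic : set R) x * f x ^+ 2) =
    - (2 * pairing (fun x => psi x * f x) g))%R.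
  (* Only forward quotients are required. At the corners [a] and [b] the right derivatives of the
     ramp are 1 and 0, the values of the indicator of the half-open interval. *)
  apply: (@weak_square_ibp f g psi _ (b - a) 1) => //.
  have small (c : R) : 0 < c -> \forall n \near \oo, (n.+1%:R^-1 : R) < c.
    move=> c0; have /cvgr_lt := @cvg_harmonic R; exact.
  have i0 (n : nat) : 0 < n.+1%:R^-1 :> R by rewrite invr_gt0 ltr0n.
  have n0 (n : nat) : n.+1%:R != 0 :> R by rewrite pnatr_eq0.
  move=> x; rewrite indicE; apply: cvg_near_cst.
  have [xa|xa] := ltP x a.
    rewrite memNset; last by rewrite /= in_itv/= leNgt xa.
    have ax : 0 < a - x by rewrite subr_gt0.
    apply: filterS (small _ ax) => n h; have h0 := i0 n.
    have -> : psi x = 0 by rewrite psiE ifT// ltW.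
    have -> : psi (x + n.+1%:R^-1) = 0 by rewrite psiE ifT// -lerBrDl ltW.
    by rewrite subrr mulr0.
  have [xb|xb] := ltP x b.
    rewrite mem_set; last by rewrite /= in_itv/= xa.
    have bx : 0 < b - x by rewrite subr_gt0.
    apply: filterS (small _ bx) => n h; have h0 := i0 n.
    have -> : psi (x + n.+1%:R^-1) = x + n.+1%:R^-1 - a.
      have e1 : (x + n.+1%:R^-1 <= a) = false.
        by apply/negbTE; rewrite -ltNge ltr_pwDr.
      have e2 : x + n.+1%:R^-1 <= b by rewrite -lerBrDl ltW.
      by rewrite psiE e1 e2.
    have -> : psi x = x - a.
      by rewrite psiE; case: ifPn => [?|_]; [lra|rewrite ltW].
    have -> : x + n.+1%:R^-1 - a - (x - a) = n.+1%:R^-1 by ring.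
    by rewrite mulfV.
  rewrite memNset; last by rewrite /= in_itv/= ltNge xb andbF.
  apply: nearW => n; have h0 := i0 n.
  have psige y : b <= y -> psi y = b - a.
    move=> yb; rewrite psiE ifF; last by apply/negbTE; rewrite -ltNge; lra.
    by case: (leP y b) => // ?; lra.
  rewrite !psige// ?subrr ?mulr0//.
  by rewrite (le_trans xb)// lerDl ltW.
have hpf : inL2 (fun x => psi x * f x) by apply: (inL2_bddM mpsi psib hf).
have := pairing_CS hpf hg; have := nrm_bddM mpsi psib hf.
set A := nrm (fun x => _); set B := pairing _ _.
have g0 := nrm_ge0 g; have f0 := nrm_ge0 f.
rewrite ler_norml => h1 /andP[h2 _].
have h3 : A * nrm g <= (b - a) * nrm f * nrm g by rewrite ler_wpM2r.
have h4 : 2 * (nrm f * nrm g) <= nrm f ^+ 2 + nrm g ^+ 2.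
  by have := sqr_ge0 (nrm f - nrm g); lra.
have h5 : (b - a) * (2 * (nrm f * nrm g)) <= (b - a) * (nrm f ^+ 2 + nrm g ^+ 2).
  by rewrite ler_pM2l.
lra.
Qed.

(** The ramp estimate on a cell bounds the average of f^2 there by the squared H1 norm; averages on
    shrinking cells converge to f^2 almost everywhere. *)
Theorem weak_sobolev f g : inL2 f -> inL2 g -> is_weak_derivative f g ->
  {ae mu, forall x, `|f x| <= Num.sqrt (nrm f ^+ 2 + nrm g ^+ 2)}.
Proof.
move=> hf hg H.
apply: (@filterS _ _ (ae_filter_ringOfSetsType mu)) (ae_le_of_cell_average (M := nrm f ^+ 2 + nrm g ^+ 2) (inL2_sqr hf) _).
  by move=> x fx; rewrite -sqrtr_sqr ler_sqrt// addr_ge0 ?sqr_ge0.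
move=> n m; have n0 : 0 < n.+1%:R :> R by rewrite ltr0n.
have ab : m%:~R / n.+1%:R < (m + 1)%:~R / n.+1%:R :> R.
  by rewrite ltr_pM2r ?invr_gt0// ltr_int ltrDl.
apply: le_trans (ramp_sqr_le hf hg H ab) _.
by rewrite -mulrBl intrD addrAC subrr add0r mul1r.
Qed.

End weak_derivatives.

(** * The local energy identity *)

Section cutoff.
Context {R : realType}.
Implicit Types (x r : R).

Definition bump x : R := step (-1 * x + 2) * step (1 * x + 2).

Lemma test_bump : test_function bump.
Proof.
apply: (@test_functionI _ _ 2).
  by apply: smoothM; apply: smooth_affine; exact: smooth_step.
move=> x; case: (ger0P x) => x0 h; rewrite /bump.
  by rewrite step_le0 ?mul0r//; lra.
by rewrite [X in _ * X]step_le0 ?mulr0//; lra.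
Qed.

Lemma bump_itv x : 0 <= bump x <= 1.
Proof.
have /andP[h1 h2] := step_itv (-1 * x + 2); have /andP[h3 h4] := step_itv (1 * x + 2).
by rewrite mulr_ge0// mulr_ile1.
Qed.

Lemma bump_eq1 x : `|x| <= 1 -> bump x = 1.
Proof.
by rewrite ler_norml => /andP[h1 h2]; rewrite /bump !step_ge1 ?mulr1//; lra.
Qed.

Lemma bump_eq0 x : 2 <= `|x| -> bump x = 0.
Proof.
case: (ger0P x) => x0 h; rewrite /bump.
  by rewrite step_le0 ?mul0r//; lra.
by rewrite [X in _ * X]step_le0 ?mulr0//; lra.
Qed.

(** Equal to 1 for |x| <= r and to 0 for |x| >= 2r. The [+ 0] fits the affine form of
    [test_affine]. *)
Definition cutoff r x := bump (r^-1 * x + 0).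

Lemma test_cutoff r : 0 < r -> test_function (cutoff r).
Proof. by move=> r0; apply: test_affine test_bump; rewrite invr_eq0 gt_eqF. Qed.

Lemma cutoff_itv r x : 0 <= cutoff r x <= 1.
Proof. exact: bump_itv. Qed.

Lemma cutoff_eq1 r x : 0 < r -> `|x| <= r -> cutoff r x = 1.
Proof.
move=> r0 xr; rewrite /cutoff addr0 bump_eq1// normrM normfV (gtr0_norm r0).
by rewrite ler_pdivrMl// mulr1.
Qed.

Lemma cutoff_eq0 r x : 0 < r -> 2 * r <= `|x| -> cutoff r x = 0.
Proof.
move=> r0 xr; rewrite /cutoff addr0 bump_eq0// normrM normfV (gtr0_norm r0).
by rewrite ler_pdivlMl// mulrC.
Qed.

(** The bound for [bump], rescaled; this 1/r is the origin of t / r in the final estimate. *)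
Lemma cutoff_derive1 : exists2 K, 0 < K &
  forall r x, 0 < r -> `|derive1 (cutoff r) x| <= K / r.
Proof.
have [K K0 HK] := test_bounded (test_derive1 test_bump).
exists K => // r x r0.
have da : is_derive x (1 : R) (fun y => r^-1 * y + 0) r^-1.
  have := is_deriveD (is_deriveZ r^-1 (is_derive_id x (1 : R))) (is_derive_const 0 x).
  by apply: is_derive_ext => //; rewrite addr0 -[_ *: _]/(_ * _) mulr1.
have := @is_derive1_comp R bump _ x _ _ (smooth_is_derive _ (test_smooth test_bump)) da.
move=> /is_derive_derive1; rewrite -/(cutoff r) => E.
have -> : derive1 (cutoff r) x = derive1 bump (r^-1 * x + 0) * r^-1 by exact: E.
by rewrite normrM normfV (gtr0_norm r0) ler_wpM2r// invr_ge0 ltW.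
Qed.

End cutoff.

(** * Products with u and the equations in transport form *)

Section energy.
Context {R : realType}.
Local Notation mu := (@lebesgue_measure R).
Implicit Types (f g phi chi : R -> R) (a b c x y t s : R).

Lemma le_Rint_ae f g : inL1 f -> inL1 g -> {ae mu, forall x, f x <= g x} ->
  (\int[mu]_x f x <= \int[mu]_x g x)%R.
Proof.
move=> hf hg fg; have mf := inL1_meas hf; have mg := inL1_meas hg.
have mm : measurable_fun setT (fun x => Num.min (f x) (g x)) by exact: measurable_minr.
have E : {ae mu, forall x, f x = Num.min (f x) (g x)}.
  by apply: (@filterS _ _ (ae_filter_ringOfSetsType mu)) fg => x /min_idPl ->.
rewrite (ae_Rint mf mm E); apply: le_Rint => //.
  exact: inL1_ae mm hf E.
by move=> x; rewrite ge_min lexx orbT.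
Qed.

Lemma nrm_ae_bddM f g (M : R) : 0 <= M -> inL2 f -> inL2 (fun x => g x * f x) ->
  {ae mu, forall x, `|g x| <= M} -> nrm (fun x => g x * f x) <= M * nrm f.
Proof.
move=> M0 hf hgf gM.
rewrite -(@ler_pXn2r _ 2)// ?nnegrE ?mulr_ge0 ?nrm_ge0// exprMn !nrm_sqr.
rewrite /pairing -RintZ; last exact: inL2_inL1M.
apply: le_Rint_ae; [exact: inL2_inL1M|by apply: inL1Z; exact: inL2_inL1M|].
apply: (@filterS _ _ (ae_filter_ringOfSetsType mu)) gM => x gx.
rewrite -!expr2 exprMn ler_wpM2r ?sqr_ge0//.
by rewrite -[g x ^+ 2]real_normK ?num_real// lerXn2r ?nnegrE.
Qed.

Lemma weak_derivativeB f f' g g' : inL2 f -> inL2 f' -> inL2 g -> inL2 g' ->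
  is_weak_derivative f g -> is_weak_derivative f' g' ->
  is_weak_derivative (fun x => f x - f' x) (fun x => g x - g' x).
Proof.
move=> hf hf' hg hg' H H' phi tp; have hp := test_L2 tp.
have hp' := test_L2 (test_derive1 tp).
by rewrite !pairingBl// H// H'//; ring.
Qed.

(** Write the increment as u(t) (f(t) - f(t0)) + (u(t) - u(t0)) f(t0). The first term uses |u| <= 1;
    in the second, u(t) - u(t0) is small in the supremum norm by the Sobolev inequality, which is
    where continuity of [ux] enters. *)
Lemma curve_mul (u ux f : R -> R -> R) : curve u -> curve ux ->
  (forall t, is_weak_derivative (u t) (ux t)) -> (forall t x, `|u t x| <= 1) ->
  curve f -> curve (fun t x => u t x * f t x).
Proof.
move=> [uL cu] [uxL cux] uw ub [fL cf].
have mu' t := inL2_meas (uL t).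
have h1 t t0 : inL2 (fun x => u t x * f t0 x) by exact: inL2_bddM (ub t) _.
split=> // t0.
apply: (@squeeze_cvgr _ _ _ _ (fun=> 0) (fun t => nrm (fun x => f t x - f t0 x) +
  Num.sqrt (nrm (fun x => u t x - u t0 x) ^+ 2 + nrm (fun x => ux t x - ux t0 x) ^+ 2) * nrm (f t0))).
- near=> t; rewrite nrm_ge0/=.
  have hd : inL2 (fun x => u t x * (f t x - f t0 x)).
    by apply: inL2_bddM (ub t) _ => //; exact: inL2B.
  have he : inL2 (fun x => (u t x - u t0 x) * f t0 x).
    have := inL2B (h1 t t0) (h1 t0 t0); congr inL2.
    by apply/funext => x; rewrite mulrBl.
  apply: (le_trans (y := nrm (fun x => u t x * (f t x - f t0 x)) + nrm (fun x => (u t x - u t0 x) * f t0 x))).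
    apply: le_trans (nrmD hd he).
    by rewrite le_eqVlt; apply/orP; left; apply/eqP; congr nrm; apply/funext => x; ring.
  apply: lerD.
    by rewrite -[leRHS]mul1r; apply: nrm_bddM (ub t) _ => //; exact: inL2B.
  apply: nrm_ae_bddM => //.
  apply: weak_sobolev; [exact: inL2B|exact: inL2B|exact: weak_derivativeB].
- exact: cvg_cst.
- rewrite [X in _ --> X](_ : _ = 0 + Num.sqrt (0 * 0 + 0 * 0) * nrm (f t0)); last first.
    by rewrite mulr0 addr0 sqrtr0 mul0r addr0.
  apply: cvgD; first exact: cf.
  apply: cvgM; last exact: cvg_cst.
  apply: (@cvg_comp _ _ _ (fun t => nrm (fun x => u t x - u t0 x) ^+ 2 + nrm (fun x => ux t x - ux t0 x) ^+ 2) Num.sqrt).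
    by apply: cvgD; under eq_fun do rewrite expr2; apply: cvgM.
  exact: sqrt_continuous.
Unshelve. all: end_near. Qed.

Lemma curve_pairing_continuous (w z : R -> R -> R) t : curve w -> curve z ->
  pairing (w r) (z r) @[r --> t] --> pairing (w t) (z t).
Proof. by move=> [wL cw] [zL cz]; apply: pairing_cvg. Qed.

(** The weight is placed on one factor only. Integrability is part of the conclusion so that several
    such derivatives can later be merged under one integral. *)
Lemma transport_weighted s (w1 F1 w2 F2 : R -> R -> R) chi t :
  transport s w1 F1 -> transport s w2 F2 -> test_function chi -> 0 < t ->
  let f x := chi x * (F1 t x * w2 t x + w1 t x * F2 t x)
    + s * (derive1 chi x * (w1 t x * w2 t x)) in
  inL1 f /\ is_derive t (1 : R) (fun r => pairing (w1 r) (fun x => chi x * w2 r x))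
    (\int[mu]_x f x)%R.
Proof.
move=> tr1 tr2 tc t0 f.
have trw := transport_weight tr2 tc.
have [c1 [F1L _] _] := tr1; have [[w2L _] [F2L _] _] := tr2; have [[wL _] [FL _] _] := trw.
have [w1L _] := c1.
have i1 := inL2_inL1M (F1L t) (wL t); have i2 := inL2_inL1M (w1L t) (FL t).
have E x : F1 t x * (chi x * w2 t x) + w1 t x * (chi x * F2 t x + s * (derive1 chi x * w2 t x)) = f x.
  by rewrite /f; ring.
split; first by have := inL1D i1 i2; apply: eq_integrable => // x _ /=; rewrite E.
have := transport_pairing tr1 trw t0; apply: is_derive_ext => //.
by rewrite -RintD//; apply: eq_Rint.
Qed.


Lemma is_deriveDr f g t a b : is_derive t (1 : R) f a -> is_derive t (1 : R) g b ->
  is_derive t (1 : R) (fun r => f r + g r) (a + b).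
Proof. exact: is_deriveD. Qed.

Lemma is_deriveZr c f t a : is_derive t (1 : R) f a ->
  is_derive t (1 : R) (fun r => c * f r) (c * a).
Proof. exact: is_deriveZ. Qed.

(* The system with u bounded pointwise and all curves defined for t : R; negative
   times are irrelevant, they only spare one-sided limits at t = 0. *)
Record kgz (u ux ut n v : R -> R -> R) : Prop := {
  kgz_u : curve u;
  kgz_ux : curve ux;
  kgz_ut : curve ut;
  kgz_n : curve n;
  kgz_v : curve v;
  kgz_bdd : forall t x, `|u t x| <= 1;
  kgz_weak : forall t, is_weak_derivative (u t) (ux t);
  kgz_eq_ut : forall phi, test_function phi -> forall t, 0 < t ->
    is_derive t (1 : R) (fun r => pairing (u r) phi) (pairing (ut t) phi);
  kgz_eq_u : forall phi, test_function phi -> forall t, 0 < t ->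
    is_derive t (1 : R) (fun r => pairing (ut r) phi)
      (pairing (u t) (derive1 (derive1 phi)) - pairing (u t) phi
        - pairing (fun x => n t x * u t x) phi);
  kgz_eq_n : forall phi, test_function phi -> forall t, 0 < t ->
    is_derive t (1 : R) (fun r => pairing (n r) phi) (pairing (v t) (derive1 phi));
  kgz_eq_v : forall phi, test_function phi -> forall t, 0 < t ->
    is_derive t (1 : R) (fun r => pairing (v r) phi)
      (pairing (fun x => n t x + u t x ^+ 2) (derive1 phi)) }.

Section kgz_transport.
Variables (u ux ut n v : R -> R -> R).
Hypothesis H : kgz u ux ut n v.

Let cu := kgz_u H.
Let cux := kgz_ux H.
Let cut := kgz_ut H.
Let cn := kgz_n H.
Let cv := kgz_v H.
Let ub := kgz_bdd H.
Let uw := kgz_weak H.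
Let uL t : inL2 (u t). Proof. by case: cu. Qed.
Let uxL t : inL2 (ux t). Proof. by case: cux. Qed.
Let utL t : inL2 (ut t). Proof. by case: cut. Qed.
Let nL t : inL2 (n t). Proof. by case: cn. Qed.
Let vL t : inL2 (v t). Proof. by case: cv. Qed.

Let curve_umul (f : R -> R -> R) : curve f -> curve (fun t x => u t x * f t x).
Proof. exact: (curve_mul cu cux uw ub). Qed.

Definition kgz_src t x := -1 * (u t x + u t x * n t x).
(** The weak derivative of u^2. *)
Definition kgz_grad t x := 2 * (u t x * ux t x).

Let curve_src : curve kgz_src.
Proof. by apply/curveZ/curveD => //; exact: curve_umul. Qed.

Let curve_grad s : curve (fun t x => s * - kgz_grad t x).
Proof.
have -> : (fun t x => s * - kgz_grad t x) = (fun t x => (- (s * 2)) * (u t x * ux t x)).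
  by apply/funext => t; apply/funext => x; rewrite /kgz_grad; ring.
by apply/curveZ/curve_umul.
Qed.

(** Holds for every [s], the term s u_x being put into the source; so u can be multiplied with a
    wave of either speed. *)
Lemma transport_u s : transport s u (fun t x => ut t x + s * ux t x).
Proof.
split=> //; first by apply: curveD => //; exact: curveZ.
move=> phi tp t t0; apply: is_derive_ext (kgz_eq_ut H tp t0) => //.
have hp := test_L2 tp.
rewrite pairingDl//; last exact: inL2Z.
by rewrite (uw t tp) pairingZl//; ring.
Qed.

(* [transport_wave] and [transport_acoustic] are the equations of the Riemann
   invariants u_t -+ u_x and n +- v, which travel with speed s = 1 or s = -1. *)
Lemma transport_wave s : s ^+ 2 = 1 -> transport s (fun t x => ut t x + (- s) * ux t x) kgz_src.
Proof.
move=> s2; split=> //; first by apply: curveD => //; exact: curveZ.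
move=> phi tp t t0; have hp := test_L2 tp; have tp' := test_derive1 tp; have hp' := test_L2 tp'.
(* Paired with phi, u_t - s u_x is the pairing of u_t with phi plus s times that of u with phi'. So
   u_x is never differentiated in time. *)
have d1 := kgz_eq_u H tp t0; have d2 := is_deriveZr s (kgz_eq_ut H tp' t0).
have := is_deriveDr d1 d2; apply: is_derive_ext.
  move=> r; rewrite pairingDl//; last exact: inL2Z.
  rewrite pairingZl//.
  have -> : pairing (ux r) phi = - pairing (u r) (derive1 phi) by rewrite uw// opprK.
  by ring.
have [[unL _] _] := (curve_umul cn, tt).
rewrite !pairingDl//; try exact: inL2Z.
rewrite !pairingZl//; last by apply: inL2D.
rewrite pairingDl// (uw t tp').
have -> : pairing (fun x => n t x * u t x) phi = pairing (fun x => u t x * n t x) phi.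
  by apply: eq_Rint => x; ring.
set A := pairing (ut t) _; set B := pairing (ux t) _; set C := pairing (u t) phi; set D := pairing _ phi.
have -> : s * (A + - s * B) = s * A - s ^+ 2 * B by ring.
by rewrite s2; ring.
Qed.

Lemma transport_acoustic s : s ^+ 2 = 1 ->
  transport s (fun t x => n t x + s * v t x) (fun t x => s * - kgz_grad t x).
Proof.
move=> s2; split=> //; first by apply: curveD => //; exact: curveZ.
move=> phi tp t t0; have hp := test_L2 tp; have tp' := test_derive1 tp; have hp' := test_L2 tp'.
have d1 := kgz_eq_n H tp t0; have d2 := is_deriveZr s (kgz_eq_v H tp t0).
have := is_deriveDr d1 d2; apply: is_derive_ext.
  by move=> r; rewrite pairingDl ?pairingZl//; exact: inL2Z.
have uu : inL2 (fun x => u t x ^+ 2).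
  by have [/(_ t)] := curve_umul cu; under eq_fun do rewrite -expr2.
have ug : inL2 (kgz_grad t) by apply/inL2Z; case: (curve_umul cux).
rewrite pairingDl// (weak_derivative_sqr (uL t) (uxL t) (uw t) tp).
rewrite (pairingDl (nL t) (inL2Z s (vL t)) hp').
rewrite (pairingZl s (vL t) hp') (pairingZl s (inL2N ug) hp) (pairingNl ug hp).
rewrite -/(kgz_grad t).
set A := pairing (n t) _; set B := pairing (v t) _; set C := pairing (kgz_grad t) _.
have -> : s * (A + s * B) + s * - C = s ^+ 2 * B + s * (A - C) by ring.
by rewrite s2 mul1r.
Qed.

(* The pairing of u^2 with phi is the pairing of u with phi u. *)
Lemma transport_u2 s : transport s (fun t x => u t x * u t x)
  (fun t x => 2 * (u t x * (ut t x + s * ux t x))).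
Proof.
have cb : curve (fun t x => ut t x + s * ux t x) by apply: curveD => //; exact: curveZ.
split; [exact: curve_umul|by apply/curveZ/curve_umul|].
move=> phi tp t t0; have hp := test_L2 tp; have tp' := test_derive1 tp; have hp' := test_L2 tp'.
have [i1 d] := transport_weighted (transport_u s) (transport_u s) tp t0.
apply: is_derive_ext d; first by move=> r; apply: eq_Rint => x; ring.
have [/(_ t) uuL _] := curve_umul cu; have [/(_ t) ubL _] := curve_umul cb.
rewrite /pairing -RintZ; last exact: inL2_inL1M.
rewrite -RintD; last first.
- by apply: inL2_inL1M => //; exact: inL2Z.
- by apply: inL1Z; exact: inL2_inL1M.
by apply: eq_Rint => x; ring.
Qed.

End kgz_transport.

End energy.

(** * Conservation and finite speed of the energy *)

Section energy_identity.
Context {R : realType}.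
Local Notation mu := (@lebesgue_measure R).
Implicit Types (f g phi chi : R -> R) (a b c x y t s : R).

Section kgz_energy.
Variables (u ux ut n v : R -> R -> R).
Hypothesis H : kgz u ux ut n v.

Let cu := kgz_u H.
Let cux := kgz_ux H.
Let cut := kgz_ut H.
Let cn := kgz_n H.
Let cv := kgz_v H.
Let ub := kgz_bdd H.
Let uw := kgz_weak H.
Let uL t : inL2 (u t). Proof. by case: cu. Qed.
Let uxL t : inL2 (ux t). Proof. by case: cux. Qed.
Let utL t : inL2 (ut t). Proof. by case: cut. Qed.
Let nL t : inL2 (n t). Proof. by case: cn. Qed.
Let vL t : inL2 (v t). Proof. by case: cv. Qed.

Let curve_umul (f : R -> R -> R) : curve f -> curve (fun t x => u t x * f t x).
Proof. exact: (curve_mul cu cux uw ub). Qed.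

Definition density t x := ut t x ^+ 2 + ux t x ^+ 2 + u t x ^+ 2
  + 2^-1 * (n t x ^+ 2 + v t x ^+ 2) + n t x * u t x ^+ 2.

Definition flux t x := - 2 * ut t x * ux t x + v t x * n t x + v t x * u t x ^+ 2.

(* Speed of propagation at most 1; this is where |u| <= 1 enters. *)
Lemma density_flux t x : `|flux t x| <= density t x.
Proof.
have := ub t x; rewrite ler_norml => /andP[u1 u2].
have u4 : 0 <= u t x ^+ 2 * (1 - u t x ^+ 2).
  by apply: mulr_ge0; [exact: sqr_ge0|nra].
(* The density plus or minus the flux is (u_t -+ u_x)^2 + (n + u^2 +- v)^2 / 2 + u^2 - u^4 / 2, and
   u^4 <= u^2. *)
rewrite /flux /density ler_norml; apply/andP; split.
  have := sqr_ge0 (ut t x - ux t x); have := sqr_ge0 (n t x + u t x ^+ 2 + v t x).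
  nra.
have := sqr_ge0 (ut t x + ux t x); have := sqr_ge0 (n t x + u t x ^+ 2 - v t x).
nra.
Qed.

(** The right side minus the left is 7 u_t^2 + 7 u_x^2 + 3 v^2 + (3n + 4u^2)^2 / 3 + 7 u^2 - (16/3)
    u^4, which is nonnegative because u^4 <= u^2. *)
Lemma density_coercive t x :
  u t x ^+ 2 + ux t x ^+ 2 + ut t x ^+ 2 + n t x ^+ 2 + v t x ^+ 2 <= 8 * density t x.
Proof.
have := ub t x; rewrite ler_norml => /andP[u1 u2].
have u4 : 0 <= u t x ^+ 2 * (1 - u t x ^+ 2).
  by apply: mulr_ge0; [exact: sqr_ge0|nra].
rewrite /density.
have := sqr_ge0 (3 * n t x + 4 * u t x ^+ 2).
have := sqr_ge0 (ut t x); have := sqr_ge0 (ux t x); have := sqr_ge0 (v t x).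
nra.
Qed.

Lemma density_ge0 t x : 0 <= density t x.
Proof. exact: le_trans (density_flux t x). Qed.

Definition local_energy (chi : R -> R) t := (\int[mu]_x (chi x * density t x))%R.

Lemma local_energyE chi M t : measurable_fun setT chi -> (forall x, `|chi x| <= M) ->
  inL1 (fun x => chi x * density t x) /\ local_energy chi t =
  pairing (ut t) (fun x => chi x * ut t x) + pairing (ux t) (fun x => chi x * ux t x)
  + pairing (u t) (fun x => chi x * u t x)
  + 2^-1 * pairing (n t) (fun x => chi x * n t x)
  + 2^-1 * pairing (v t) (fun x => chi x * v t x)
  + pairing (n t) (fun x => chi x * (u t x * u t x)).
Proof.
move=> mc cM.
have K f g : inL2 f -> inL2 g -> inL1 (fun x => f x * (chi x * g x)).
  by move=> hf hg; apply: inL2_inL1M => //; exact: inL2_bddM cM _.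
have [/(_ t) uuL _] := curve_umul cu.
have k1 := K _ _ (utL t) (utL t); have k2 := K _ _ (uxL t) (uxL t).
have k3 := K _ _ (uL t) (uL t); have k4 := inL1Z 2^-1 (K _ _ (nL t) (nL t)).
have k5 := inL1Z 2^-1 (K _ _ (vL t) (vL t)); have k6 := K _ _ (nL t) uuL.
have j2 := inL1D k1 k2; have j3 := inL1D j2 k3; have j4 := inL1D j3 k4.
have j5 := inL1D j4 k5; have j6 := inL1D j5 k6.
split.
  by apply: eq_integrable j6 => // x _ /=; congr EFin; rewrite /density; ring.
rewrite /pairing -!RintZ; [|exact: K|exact: K].
rewrite -(RintD k1 k2) -(RintD j2 k3) -(RintD j3 k4) -(RintD j4 k5) -(RintD j5 k6).
by apply: eq_Rint => x; rewrite /density; ring.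
Qed.

Lemma local_energy_continuous chi M t : measurable_fun setT chi ->
  (forall x, `|chi x| <= M) -> local_energy chi r @[r --> t] --> local_energy chi t.
Proof.
move=> mc cM; rewrite (local_energyE t mc cM).2.
under eq_fun => r do rewrite (local_energyE r mc cM).2.
have K w z : curve w -> curve z ->
    pairing (w r) (fun x => chi x * z r x) @[r --> t] --> pairing (w t) (fun x => chi x * z t x).
  move=> cw cz; apply: (curve_pairing_continuous (z := fun r x => chi x * z r x)) => //.
  exact: curve_bddM cz.
have cuu := curve_umul cu.
have c2 : (fun _ : R => 2^-1 : R) @ t --> (2^-1 : R) by exact: cvg_cst.
exact: (cvgD (cvgD (cvgD (cvgD (cvgD (K _ _ cut cut) (K _ _ cux cux)) (K _ _ cu cu))
  (cvgM c2 (K _ _ cn cn))) (cvgM c2 (K _ _ cv cv))) (K _ _ cn cuu)).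
Qed.

(* The density is the sum over s = 1, -1 of
   (u_t - s u_x)^2 / 2 + (n + s v)^2 / 4 + (n + s v) u^2 / 2 + u^2 / 2, each summand
   being transported with speed s up to sources which cancel in the sum. *)
Lemma local_energy_derive chi t : test_function chi -> 0 < t ->
  is_derive t (1 : R) (local_energy chi) (\int[mu]_x (derive1 chi x * flux t x))%R.
Proof.
move=> tc t0; have mc := test_measurable tc; have [M M0 HM] := test_bounded tc.
have s1 : (1 : R) ^+ 2 = 1 by rewrite expr1n.
have s2 : (-1 : R) ^+ 2 = 1 by rewrite sqrrN expr1n.
have [i1 d1] := transport_weighted (transport_wave H s1) (transport_wave H s1) tc t0.
have [i2 d2] := transport_weighted (transport_wave H s2) (transport_wave H s2) tc t0.
have [i3 d3] := transport_weighted (transport_acoustic H s1) (transport_acoustic H s1) tc t0.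
have [i4 d4] := transport_weighted (transport_acoustic H s2) (transport_acoustic H s2) tc t0.
have [i5 d5] := transport_weighted (transport_acoustic H s1) (transport_u2 H 1) tc t0.
have [i6 d6] := transport_weighted (transport_acoustic H s2) (transport_u2 H (-1)) tc t0.
have [i7 d7] := transport_weighted (transport_u H 1) (transport_u H 1) tc t0.
have [i8 d8] := transport_weighted (transport_u H (-1)) (transport_u H (-1)) tc t0.
have D := is_deriveDr (is_deriveDr (is_deriveDr (is_deriveZr (2^-1 : R) (is_deriveDr d1 d2))
  (is_deriveZr (4^-1 : R) (is_deriveDr d3 d4))) (is_deriveZr (2^-1 : R) (is_deriveDr d5 d6)))
  (is_deriveZr (2^-1 : R) (is_deriveDr d7 d8)).
apply: is_derive_ext D.
  move=> r; have K f g : inL2 f -> inL2 g -> inL1 (fun x => f x * (chi x * g x)).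
    by move=> hf hg; apply: inL2_inL1M => //; exact: inL2_bddM HM _.
  have [/(_ r) uuL _] := curve_umul cu.
  have hw s : inL2 (fun x => ut r x + s * ux r x) by apply: inL2D => //; exact: inL2Z.
  have hp s : inL2 (fun x => n r x + s * v r x) by apply: inL2D => //; exact: inL2Z.
  rewrite {d1 d2 d3 d4 d5 d6 d7 d8 i1 i2 i3 i4 i5 i6 i7 i8}.
  have l1 := K _ _ (hw (-1)) (hw (-1)); have l2 := K _ _ (hw (- -1)) (hw (- -1)).
  have l3 := K _ _ (hp 1) (hp 1); have l4 := K _ _ (hp (-1)) (hp (-1)).
  have l5 := K _ _ (hp 1) uuL; have l6 := K _ _ (hp (-1)) uuL.
  have l7 := K _ _ (uL r) (uL r).
  have m1 := inL1D l1 l2; have m2 := inL1D l3 l4; have m3 := inL1D l5 l6.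
  have m4 := inL1D l7 l7.
  rewrite /pairing -(RintD l1 l2) -(RintD l3 l4) -(RintD l5 l6) -(RintD l7 l7).
  rewrite -(RintZ _ m1) -(RintZ _ m2) -(RintZ _ m3) -(RintZ _ m4).
  have o1 := inL1Z 2^-1 m1; have o2 := inL1Z 4^-1 m2; have o3 := inL1Z 2^-1 m3.
  have o4 := inL1Z 2^-1 m4; have q1 := inL1D o1 o2; have q2 := inL1D q1 o3.
  rewrite -(RintD o1 o2) -(RintD q1 o3) -(RintD q2 o4).
  by apply: eq_Rint => x; rewrite /density; field.
have k1 := inL1D i1 i2; have k2 := inL1D i3 i4; have k3 := inL1D i5 i6; have k4 := inL1D i7 i8.
have j1 := inL1Z 2^-1 k1; have j2 := inL1Z 4^-1 k2.
have j3 := inL1Z 2^-1 k3; have j4 := inL1Z 2^-1 k4.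
have j12 := inL1D j1 j2; have j123 := inL1D j12 j3.
rewrite -(RintD i1 i2) -(RintD i3 i4) -(RintD i5 i6) -(RintD i7 i8).
rewrite -(RintZ _ k1) -(RintZ _ k2) -(RintZ _ k3) -(RintZ _ k4).
rewrite -(RintD j1 j2) -(RintD j12 j3) -(RintD j123 j4).
(* The terms carrying chi cancel pointwise. Those carrying chi' keep the sign [s], so only the
   differences between the two speeds survive, and these form the flux. *)
by apply: eq_Rint => x; rewrite /kgz_src /kgz_grad /flux; field.
Qed.

Lemma inL1_density t : inL1 (density t).
Proof.
have [//|x|] := @local_energyE (fun=> 1) 1 t; first by rewrite normr1.
by move=> h _; apply: eq_integrable h => // x _ /=; rewrite mul1r.
Qed.

Definition total_energy t := (\int[mu]_x density t x)%R.

Lemma total_energyE : total_energy = local_energy (fun=> 1).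
Proof. by apply/funext => t; apply: eq_Rint => x; rewrite mul1r. Qed.

Lemma total_energy_continuous : continuous total_energy.
Proof.
rewrite total_energyE => t; apply: (@local_energy_continuous _ 1) => // x.
by rewrite normr1.
Qed.

Lemma inL1_flux t : inL1 (flux t).
Proof.
apply: inL1_le (inL1_density t) (density_flux t).
have m1 := inL2_meas (utL t); have m2 := inL2_meas (uxL t).
have m3 := inL2_meas (vL t); have m4 := inL2_meas (nL t); have m5 := inL2_meas (uL t).
apply: measurable_funD; last by apply: measurable_funM => //; exact: (measurable_funX 2 m5).
apply: measurable_funD; last exact: measurable_funM.
by apply: measurable_funM => //; exact: measurable_funM.
Qed.

(** The mean value theorem in time; the integrand of the derivative is at most [K] times the
    density, because the density dominates the flux. *)
Lemma energy_drift K r t B : 0 <= K -> 0 < r -> 0 <= t ->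
  (forall x, `|derive1 (cutoff r) x| <= K) -> (forall s, 0 <= s <= t -> total_energy s <= B) ->
  `|local_energy (cutoff r) t - local_energy (cutoff r) 0| <= K * B * t.
Proof.
move=> K0 r0 t0 HK HB; have tc := test_cutoff r0.
have mc := test_measurable tc; have mc' := test_measurable (test_derive1 tc).
have cM x : `|cutoff r x| <= 1.
  by have /andP[h1 h2] := cutoff_itv r x; rewrite ger0_norm.
have cont : {within `[0, t], continuous (local_energy (cutoff r))}.
  by apply: continuous_subspaceT => s; exact: local_energy_continuous.
have [|c] := @MVT_segment _ _ (fun s => \int[mu]_x (derive1 (cutoff r) x * flux s x))%R _ _ t0 _ cont.
  move=> s; rewrite in_itv/= => /andP[s0 _]; exact: local_energy_derive.
rewrite in_itv/= => cin ->; rewrite subr0 normrM (ger0_norm t0) ler_wpM2r//.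
have i1 := inL1_flux c; have i2 := inL1_bddM mc' HK i1.
have i3 := inL1Z K (inL1_density c).
apply: le_trans (ler_norm_Rint i2 i3 _) _.
  move=> x; rewrite normrM ler_pM//; exact: density_flux.
by rewrite RintZ ?ler_wpM2l ?HB//; exact: inL1_density.
Qed.

Lemma local_energy_cutoff_cvg t :
  local_energy (cutoff r) t @[r --> +oo] --> total_energy t.
Proof.
apply/cvg_pinftyP => r rlim.
have mc k : measurable_fun setT (cutoff (r k)).
  apply: (measurableT_comp (test_measurable (@test_bump R))).
  by apply: measurable_funD => //; exact: measurable_funM.
have md := inL1_meas (inL1_density t).
apply: (@Rint_cvg R (fun k x => cutoff (r k) x * density t x) (density t) (density t)
  _ md (inL1_density t) _ _).2.
- by move=> k; exact: measurable_funM.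
- move=> k x; rewrite normrM [X in _ * X]ger0_norm ?density_ge0//.
  rewrite ler_piMl ?density_ge0//.
  by have /andP[h1 h2] := cutoff_itv (r k) x; rewrite ger0_norm.
- apply: aeW => x; apply: cvg_near_cst.
  move/cvgryPge: rlim => /(_ (Num.max 1 `|x|)); apply: filterS => k.
  rewrite ge_max => /andP[r1 xr].
  by rewrite cutoff_eq1 ?mul1r// (lt_le_trans ltr01).
Qed.

(* The energy is bounded on [0, t] by continuity, so its drift inside |x| <= r is
   O(t / r); let r tend to infinity. *)
Lemma total_energy_conserved t : 0 <= t -> total_energy t = total_energy 0.
Proof.
move=> t0; have [K K0 HK] := @cutoff_derive1 R.
have cont : {within `[0, t], continuous total_energy}.
  by apply: continuous_subspaceT; exact: total_energy_continuous.
have [c _ Hc] := EVT_max t0 cont; set B := total_energy c in Hc.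
have l1 := @local_energy_cutoff_cvg t; have l2 := @local_energy_cutoff_cvg 0.
have l3 : local_energy (cutoff r) t - local_energy (cutoff r) 0 @[r --> +oo] --> 0.
  apply/norm_cvg0P.
  apply: (@squeeze_cvgr _ _ _ _ (fun=> 0) (fun r => K * B * t * r^-1)).
  - near=> r; have r0 : 0 < r by near: r; exact: nbhs_pinfty_gt.
    rewrite normr_ge0/= (le_trans (@energy_drift (K / r) r t B _ _ _ _ _))//.
    + by rewrite divr_ge0// ltW.
    + by move=> x; exact: HK.
    + by rewrite le_eqVlt; apply/orP; left; apply/eqP; ring.
  - exact: cvg_cst.
  - rewrite -[X in _ --> X](mulr0 (K * B * t)); apply: cvgM; first exact: cvg_cst.
    by apply/gtr0_cvgV0 => //; exact: nbhs_pinfty_gt.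
have E : total_energy t - total_energy 0 = 0.
  by apply: (cvg_unique (@Rhausdorff R) _ l3); exact: cvgB.
by apply/eqP; rewrite -subr_eq0 E.
Unshelve. all: end_near. Qed.

Definition exterior_energy r t := (\int[mu]_x ((1 - cutoff r x) * density t x))%R.

Lemma exterior_energyE r t : 0 < r ->
  exterior_energy r t = total_energy t - local_energy (cutoff r) t.
Proof.
move=> r0; have tc := test_cutoff r0; have [M _ HM] := test_bounded tc.
rewrite /total_energy /local_energy -RintB; last first.
- exact: (inL1_bddM (test_measurable tc) HM (inL1_density t)).
- exact: inL1_density.
by apply: eq_Rint => x; ring.
Qed.

(** By conservation, what leaves the cutoff region enters the exterior; conservation also bounds the
    energy at all intermediate times by its initial value, so [K] depends on neither [r] nor [t]. *)
Lemma exterior_energy_le : exists2 K, 0 < K & forall r t, 0 < r -> 0 <= t ->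
  exterior_energy r t <= exterior_energy r 0 + K * total_energy 0 * (t / r).
Proof.
have [K K0 HK] := @cutoff_derive1 R; exists K => // r t r0 t0.
rewrite !exterior_energyE// total_energy_conserved//.
have Kr : 0 <= K / r by rewrite divr_ge0// ltW.
have D := @energy_drift (K / r) r t (total_energy 0) Kr r0 t0.
have : `|local_energy (cutoff r) t - local_energy (cutoff r) 0| <= K / r * total_energy 0 * t.
  apply: D; first by move=> x; exact: HK.
  by move=> s /andP[s0 _]; rewrite total_energy_conserved.
rewrite ler_norml => /andP[h _].
have -> : K * total_energy 0 * (t / r) = K / r * total_energy 0 * t by ring.
lra.
Qed.

Lemma exterior_energy_cvg t : exterior_energy r t @[r --> +oo] --> 0.
Proof.
have : total_energy t - local_energy (cutoff r) t @[r --> +oo] --> total_energy t - total_energy t.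
  by apply: cvgB; [exact: cvg_cst|exact: local_energy_cutoff_cvg].
rewrite subrr; apply: cvg_trans; apply: near_eq_cvg; near=> r.
by rewrite exterior_energyE//; near: r; exact: nbhs_pinfty_gt.
Unshelve. all: end_near. Qed.

End kgz_energy.
End energy_identity.

(** * Solutions of the Klein-Gordon-Zakharov system *)

Section assembly.
Context {R : realType}.
Local Notation mu := (@lebesgue_measure R).
Implicit Types (f g phi : R -> R) (t s x : R).

Lemma L2normE (A : set R) f : L2norm A f = nrm (f \_ A).
Proof.
rewrite /L2norm normE fine_poweR /nrm -powR12_sqrt ?pairing_ge0//.
Qed.

Lemma L2norm_le (A : set R) f g : measurable A -> inL2 f -> inL1 g ->
  (forall x, 0 <= g x) -> {ae mu, forall x, A x -> f x ^+ 2 <= g x} ->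
  L2norm A f <= Num.sqrt (\int[mu]_x g x)%R.
Proof.
move=> mA hf hg g0 fg; rewrite L2normE ler_sqrt; last first.
  by apply: Rintegral_ge0 => x _.
have E : f \_ A = (fun x => \1_A x * f x).
  by apply/funext => x; rewrite patchE indicE; case: (x \in A); rewrite ?mul1r ?mul0r.
have hfA : inL2 (f \_ A).
  rewrite E; apply: (@inL2_bddM _ _ _ 1) => //.
  by move=> x; rewrite indicE; case: (x \in A); rewrite ?normr1 ?normr0.
apply: le_Rint_ae => //; first exact: inL2_inL1M.
apply: (@filterS _ _ (ae_filter_ringOfSetsType mu)) fg => x fx.
rewrite patchE; case: ifPn => [|_]; last by rewrite mul0r.
by rewrite inE => /fx; rewrite expr2.
Qed.

Lemma measurable_annulus (c1 c2 r : R) : measurable (annulus c1 c2 r).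
Proof.
have -> : annulus c1 c2 r = setT `&` (fun x : R => `|x|) @^-1` `[c1 * r, c2 * r]%classic.
  by rewrite setTI; apply/seteqP; split => x /=; rewrite in_itv.
have mn : measurable_fun setT (fun x : R => `|x|) by apply: measurableT_comp.
by apply: mn => //; exact: measurable_itv.
Qed.

Lemma weak_derivativeP f : inH1 f -> inL2 (weak_derivative f) /\
  is_weak_derivative f (weak_derivative f).
Proof.
move=> [_ [g [hg fg]]]; rewrite /weak_derivative.
by apply: (@xgetPex _ (cst 0) [set g | inL2 g /\ is_weak_derivative f g]); exists g.
Qed.

Lemma H1normT f : H1norm setT f = Num.sqrt (nrm f ^+ 2 + nrm (weak_derivative f) ^+ 2).
Proof. by rewrite /H1norm !L2normT. Qed.

(* Curves on [0, +oo[ are extended by their value at 0. *)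
Definition nneg t := Num.max t 0.

Lemma nneg_ge0 t : 0 <= nneg t.
Proof. by rewrite le_max lexx orbT. Qed.

Lemma nneg_id t : 0 <= t -> nneg t = t.
Proof. by move=> t0; rewrite /nneg (max_idPl t0). Qed.

(** [nneg] is 1-Lipschitz with values in the half-line, so it turns a limit within t >= 0 into a
    two-sided one. *)
Lemma cvg_nneg (F : R -> R) (t0 : R) :
  F @ within [set t | 0 <= t] (nbhs (nneg t0)) --> 0 -> F (nneg t) @[t --> t0] --> 0.
Proof.
move=> H; apply: (@cvg_comp _ _ _ nneg F _ (within [set t | 0 <= t] (nbhs (nneg t0)))) H => //.
move=> A /= [e /= e0 He]; exists e => //= s ts; apply: He; last exact: nneg_ge0.
apply: le_lt_trans ts; rewrite /nneg /Num.max.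
by do 2 case: ifPn; rewrite -?leNgt => h1 h2; rewrite ?subrr ?normr0// ler_norml; apply/andP; split;
  have := ler_norm (t0 - s); have := ler_norm (s - t0); rewrite (distrC s); lra.
Qed.

Lemma continuous_curve_L2 (w : R -> R -> R) :
  continuous_curve (@inL2 R) (@L2norm R setT) w -> curve (fun t => w (nneg t)).
Proof.
move=> [wL cw]; split=> [t|t0]; first by apply: wL; exact: nneg_ge0.
have := cw _ (nneg_ge0 t0); under eq_fun do rewrite L2normT.
exact: cvg_nneg.
Qed.

(** [weak_derivative] is a choice of representative, hence additive only up to null sets: the
    derivative of the difference, which the H1 norm sees, has to be compared with the difference of
    the derivatives. *)
Lemma continuous_curve_H1 (w : R -> R -> R) :
  continuous_curve (@inH1 R) (@H1norm R setT) w ->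
  curve (fun t => w (nneg t)) /\ curve (fun t => weak_derivative (w (nneg t))).
Proof.
move=> [wH cw].
have wL t : inL2 (w (nneg t)) by case: (wH _ (nneg_ge0 t)).
have dP t := weak_derivativeP (wH _ (nneg_ge0 t)).
have dL t := (dP t).1; have dw t := (dP t).2.
have cH t0 : H1norm setT (w (nneg t) \- w (nneg t0)) @[t --> t0] --> 0.
  exact: (cvg_nneg (cw _ (nneg_ge0 t0))).
split; split=> // t0; apply: (@squeeze_cvgr _ _ _ _ (fun=> 0) _ _ _ _ _ (cH t0));
  try exact: cvg_cst; near=> t; rewrite nrm_ge0/= H1normT.
  rewrite -[leLHS]ger0_norm ?nrm_ge0// -sqrtr_sqr ler_sqrt ?addr_ge0 ?sqr_ge0//.
  by rewrite lerDl sqr_ge0.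
have wd := weak_derivativeB (wL t) (wL t0) (dL t) (dL t0) (dw t) (dw t0).
have dd := inL2B (dL t) (dL t0).
have hH : inH1 (w (nneg t) \- w (nneg t0)).
  by split; [exact: inL2B|exists (fun x => weak_derivative (w (nneg t)) x - weak_derivative (w (nneg t0)) x)].
have [eL ew] := weak_derivativeP hH.
(* Both are weak derivatives of the same function, so their difference vanishes against every test
   function. *)
have e0 : nrm (fun x => (weak_derivative (w (nneg t)) x - weak_derivative (w (nneg t0)) x)
    - weak_derivative (w (nneg t) \- w (nneg t0)) x) = 0.
  apply: nrm_eq0_dual; first exact: inL2B.
  move=> phi tp; rewrite pairingBl//; last exact: test_L2.
  by apply: oppr_inj; rewrite opprB oppr0 -[X in X - _]opprK -ew// wd// opprK subrr.
apply: (@le_trans _ _ (nrm (weak_derivative (w (nneg t) \- w (nneg t0))))).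
  have := nrmD (inL2B dd eL) eL; rewrite e0 add0r; apply: le_trans.
  by rewrite le_eqVlt; apply/orP; left; apply/eqP; congr nrm; apply/funext => x; ring.
rewrite -[leLHS]ger0_norm ?nrm_ge0// -sqrtr_sqr ler_sqrt ?addr_ge0 ?sqr_ge0//.
by rewrite lerDr sqr_ge0.
Unshelve. all: end_near. Qed.

(* |u| <= 1 holds only almost everywhere; clipping gives a representative for which
   it holds everywhere. *)
Definition clip (y : R) := Num.max (-1) (Num.min y 1).

Lemma clip_bdd y : `|clip y| <= 1.
Proof.
rewrite ler_norml /clip le_max lexx/= ge_max ge_min lexx orbT andbT.
by rewrite lerNl; lra.
Qed.

Lemma clip_id y : `|y| <= 1 -> clip y = y.
Proof.
by rewrite ler_norml => /andP[h1 h2]; rewrite /clip (min_idPl h2) (max_idPr h1).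
Qed.

Lemma measurable_clip f : measurable_fun setT f -> measurable_fun setT (fun x => clip (f x)).
Proof. by move=> mf; apply: measurable_maxr => //; exact: measurable_minr. Qed.

Section solution.
Variables (u ut n v : R -> R -> R).
Hypothesis hsol : KGZ_solution u ut n v.
Hypothesis hsup : forall t, 0 <= t -> H1norm setT (u t) <= 1.

Let uc t x := clip (u (nneg t) x).
Let ux t := weak_derivative (u (nneg t)).

Let inL2u t : inL2 (u (nneg t)).
Proof. by have [/(_ _ (nneg_ge0 t))[]] := KGZ_u_cont hsol. Qed.

Let uE t : {ae mu, forall x, u (nneg t) x = uc t x}.
Proof.
have [/(_ _ (nneg_ge0 t)) uH _] := KGZ_u_cont hsol.
have [dL dw] := weak_derivativeP uH.
have := hsup (nneg_ge0 t); rewrite H1normT => h.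
apply: (@filterS _ _ (ae_filter_ringOfSetsType mu)) (weak_sobolev (inL2u t) dL dw) => x ux1.
by rewrite /uc clip_id// (le_trans ux1).
Qed.

Let muc t : measurable_fun setT (uc t).
Proof. by apply: measurable_clip; exact: inL2_meas. Qed.

Let nneg_near t : 0 < t -> \forall r \near t, nneg r = r.
Proof.
by move=> t0; near=> r; rewrite nneg_id// ltW//; near: r; exact: lt_nbhsr.
Unshelve. all: end_near. Qed.

(** Neither modification is visible to the equations: clipping changes u on a null set, by the
    Sobolev inequality, and extension to negative times does not affect derivatives at t > 0. *)
Lemma kgz_of_solution :
  kgz uc ux (fun t => ut (nneg t)) (fun t => n (nneg t)) (fun t => v (nneg t)).
Proof.
have [cu cux] := continuous_curve_H1 (KGZ_u_cont hsol).
have cut := continuous_curve_L2 (KGZ_ut_cont hsol).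
have cn := continuous_curve_L2 (KGZ_n_cont hsol).
have cv := continuous_curve_L2 (KGZ_v_cont hsol).
have mu' t := inL2_meas (inL2u t).
have ucL t : inL2 (uc t) by exact: inL2_ae (muc t) (inL2u t) (uE t).
have pE t phi : test_function phi -> pairing (u (nneg t)) phi = pairing (uc t) phi.
  move=> tp; have mp := test_measurable tp.
  by apply: pairing_ae => //; apply: aeW.
split => //.
- split=> // t0; have [_ /(_ t0)] := cu.
  apply: cvg_trans; apply: near_eq_cvg; near=> t.
  apply: nrm_ae; try exact: measurable_funB.
  by apply: (@filterS2 _ _ (ae_filter_ringOfSetsType mu)) (uE t) (uE t0) => x -> ->.
- by move=> t x; exact: clip_bdd.
- move=> t phi tp; have [/(_ _ (nneg_ge0 t)) uH _] := KGZ_u_cont hsol.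
  have [_ dw] := weak_derivativeP uH.
  by rewrite -pE ?dw//; exact: test_derive1.
- move=> phi tp t t0; rewrite nneg_id ?ltW//.
  apply: is_derive_near (KGZ_ut hsol tp t0).
  by near=> r; rewrite -pE//; congr pairing; congr u; apply/esym; near: r; exact: nneg_near.
- move=> phi tp t t0; have tp' := test_derive1 tp; have tp'' := test_derive1 tp'.
  have -> : pairing (uc t) (derive1 (derive1 phi)) - pairing (uc t) phi
      - pairing (fun x => n (nneg t) x * uc t x) phi =
      pairing (u t) (derive1n 2 phi) - pairing (u t) phi - pairing (n t \* u t) phi.
    have nt := nneg_id (ltW t0).
    rewrite -!pE// nt; congr (_ - _ - _); apply/esym.
    have mp := test_measurable tp; have [nL _] := cn.
    have := nL t; rewrite nt => /inL2_meas mn.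
    have := mu' t; rewrite nt => mut.
    apply: pairing_ae => //; try exact: measurable_funM; last by apply: aeW.
    apply: (@filterS _ _ (ae_filter_ringOfSetsType mu)) (uE t) => x /=.
    by rewrite nt => ->.
  apply: is_derive_near (KGZ_eq_u hsol tp t0).
  by near=> r; congr pairing; congr ut; apply/esym; near: r; exact: nneg_near.
- move=> phi tp t t0; rewrite nneg_id ?ltW//.
  apply: is_derive_near (KGZ_eq_n hsol tp t0).
  by near=> r; congr pairing; congr n; apply/esym; near: r; exact: nneg_near.
- move=> phi tp t t0; have tp' := test_derive1 tp.
  have -> : pairing (fun x => n (nneg t) x + uc t x ^+ 2) (derive1 phi) =
      pairing (fun x => n t x + u t x ^+ 2) (derive1 phi).
    have nt := nneg_id (ltW t0).
    have mp := test_measurable tp'; have [nL _] := cn.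
    have := nL t; rewrite nt => /inL2_meas mn.
    have := mu' t; rewrite nt => mut; apply/esym.
    apply: pairing_ae => //; try by [apply: measurable_funD => //; exact: measurable_funX|apply: aeW].
    apply: (@filterS _ _ (ae_filter_ringOfSetsType mu)) (uE t) => x /=.
    by rewrite nt => ->.
  apply: is_derive_near (KGZ_eq_v hsol tp t0).
  by near=> r; congr pairing; congr v; apply/esym; near: r; exact: nneg_near.
Unshelve. all: end_near. Qed.

(** [Q] is the exterior energy at time 0. The radius c1 m / 2 makes 1 - cutoff equal to 1 on |x| >=
    c1 m, which contains the annulus. The 8 comes from [density_coercive]; the 5 counts the L2 norms
    of u, u_x, u_t, n and v. *)
Lemma annulus_le_exterior : exists (E : R) (Q : R -> R),
  Q r @[r --> +oo] --> 0 /\ forall t m c1 c2 : R, 0 <= t -> 0 < c1 * m ->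
  H1norm (annulus c1 c2 m) (u t) + L2norm (annulus c1 c2 m) (ut t)
    + L2norm (annulus c1 c2 m) (n t) + L2norm (annulus c1 c2 m) (v t)
  <= 5 * Num.sqrt (8 * (Q (c1 * m / 2) + E * (t / (c1 * m / 2)))).
Proof.
have H := kgz_of_solution; have [K K0 HK] := exterior_energy_le H.
set e0 := total_energy _ _ _ _ _ 0 in HK.
exists (K * e0), (fun r => exterior_energy uc ux (fun t => ut (nneg t)) (fun t => n (nneg t)) (fun t => v (nneg t)) r 0).
split; first exact: (exterior_energy_cvg H).
move=> t m c1 c2 t0 cm /=; set A := annulus _ _ _; set r := c1 * m / 2.
have r0 : 0 < r by rewrite divr_gt0.
have mA : measurable A by exact: measurable_annulus.
have nt := nneg_id t0.
set rho := density uc ux (fun t => ut (nneg t)) (fun t => n (nneg t)) (fun t => v (nneg t)) t.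
have rho0 x : 0 <= rho x by exact: (density_ge0 H).
have c0 x : 0 <= 1 - cutoff r x by have /andP[_] := cutoff_itv r x; rewrite subr_ge0.
pose g x := 8 * ((1 - cutoff r x) * rho x).
have ig' : inL1 (fun x => (1 - cutoff r x) * rho x).
  have tc := test_cutoff r0; have [M _ HM] := test_bounded tc.
  have i1 := inL1_density H t.
  have := inL1B i1 (inL1_bddM (test_measurable tc) HM i1).
  by apply: eq_integrable => // x _ /=; congr EFin; rewrite /rho; ring.
have ig : inL1 g by exact: inL1Z.
have g0 x : 0 <= g x by rewrite !mulr_ge0.
have gA x : A x -> g x = 8 * rho x.
  move=> /andP[h _]; rewrite /g cutoff_eq0 ?subr0 ?mul1r//.
  by rewrite /r mulrC divfK.
have Ig : (\int[mu]_x g x <= 8 * (exterior_energy uc ux (fun t => ut (nneg t)) (fun t => n (nneg t))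
   (fun t => v (nneg t)) r 0 + K * e0 * (t / r)))%R.
  by rewrite RintZ// ler_pM2l//; exact: HK.
set S := Num.sqrt _.
have S0 : 0 <= S by exact: sqrtr_ge0.
(* The second function stands for the clipped representative in the case of [u]. *)
have main f f' : inL2 f -> {ae mu, forall x, f x = f' x} ->
    (forall x, f' x ^+ 2 <= 8 * rho x) -> L2norm A f <= S.
  move=> hf ff' fr; apply: (@le_trans _ _ (Num.sqrt (\int[mu]_x g x)%R)).
    apply: L2norm_le => //.
    by apply: (@filterS _ _ (ae_filter_ringOfSetsType mu)) ff' => x -> /gA ->.
  by rewrite ler_sqrt// (le_trans _ Ig)// Rintegral_ge0.
have dc x := density_coercive H t x.
have sq x := (sqr_ge0 (uc t x), sqr_ge0 (ux t x), sqr_ge0 (ut (nneg t) x),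
  sqr_ge0 (n (nneg t) x), sqr_ge0 (v (nneg t) x)).
have aer f : {ae mu, forall x, f x = f x} by apply: aeW.
have L1 : L2norm A (u t) <= S.
  rewrite -nt; apply: (main _ (uc t)); [exact: inL2u|exact: uE|].
  by move=> x; rewrite (le_trans _ (dc x))//; have := sq x => -[[[[? ?] ?] ?] ?]; lra.
have L2 : L2norm A (weak_derivative (u t)) <= S.
  have [uxL _] := kgz_ux H; rewrite -nt; apply: (main _ (ux t)); [exact: uxL|exact: aer|].
  by move=> x; rewrite (le_trans _ (dc x))//; have := sq x => -[[[[? ?] ?] ?] ?]; lra.
have L3 : L2norm A (ut t) <= S.
  have [wL _] := kgz_ut H; rewrite -nt; apply: (main _ (ut (nneg t))); [exact: wL|exact: aer|].
  by move=> x; rewrite (le_trans _ (dc x))//; have := sq x => -[[[[? ?] ?] ?] ?]; lra.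
have L4 : L2norm A (n t) <= S.
  have [wL _] := kgz_n H; rewrite -nt; apply: (main _ (n (nneg t))); [exact: wL|exact: aer|].
  by move=> x; rewrite (le_trans _ (dc x))//; have := sq x => -[[[[? ?] ?] ?] ?]; lra.
have L5 : L2norm A (v t) <= S.
  have [wL _] := kgz_v H; rewrite -nt; apply: (main _ (v (nneg t))); [exact: wL|exact: aer|].
  by move=> x; rewrite (le_trans _ (dc x))//; have := sq x => -[[[[? ?] ?] ?] ?]; lra.
have LH : H1norm A (u t) <= S + S.
  have p1 : 0 <= L2norm A (u t) by rewrite L2normE nrm_ge0.
  have p2 : 0 <= L2norm A (weak_derivative (u t)) by rewrite L2normE nrm_ge0.
  apply: (@le_trans _ _ (L2norm A (u t) + L2norm A (weak_derivative (u t)))); last exact: lerD.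
  rewrite -[leRHS]ger0_norm ?addr_ge0// -sqrtr_sqr ler_sqrt ?sqr_ge0//.
  by rewrite sqrrD lerD2r lerDl mulrn_wge0// mulr_ge0.
lra.
Qed.

End solution.

Lemma ln_cvg_pinfty : ln x @[x --> +oo] --> (+oo : set_system R).
Proof.
apply/cvgryPge => A; near=> x.
have xA : expR A <= x by near: x; apply: nbhs_pinfty_ge; exact: num_real.
by rewrite -[A]expRK ler_ln ?posrE ?expR_gt0// (lt_le_trans (expR_gt0 A)).
Unshelve. all: end_near. Qed.

(** Once ln t >= 1, raising it to the power 1 + delta cannot decrease it. *)
Lemma gtrsim_superlinear (m : R -> R) (delta : R) : 0 < delta ->
  gtrsim m (fun t : R => t * ln t `^ (1 + delta)) ->
  exists2 c, 0 < c & \forall t \near +oo, [/\ 1 <= t, 1 <= ln t & c * (t * ln t) <= m t].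
Proof.
move=> d0 [c c0 H]; exists c => //; near=> t.
have t2 : 2 <= t by near: t; exact: nbhs_pinfty_ge.
have l1 : 1 <= ln t.
  by near: t; move/cvgryPge : ln_cvg_pinfty; exact.
have t1 : 1 <= t by rewrite (le_trans _ t2)// ler1n.
split => //; apply: le_trans (H t t2); rewrite ler_pM2l// ler_pM2l ?(lt_le_trans ltr01)//.
by apply: le1r_powR => //; rewrite lerDl ltW.
Unshelve. all: end_near. Qed.

End assembly.

Theorem theorem1p5 (R : realType) (u ut n v : R -> R -> R) (eps : R)
  (hsol : KGZ_solution u ut n v)
  (hE : forall t : R, 0 <= t -> (KGZ_energy (u t) (ut t) (n t) (v t) < +oo)%E)
  (heps0 : 0 < eps) (heps1 : eps <= 1)
  (hsup : (ereal_sup [set (H1norm setT (u t))%:E | t in [set t : R | (0 <= t)%R]]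
             <= eps%:E)%E)
  (delta : R) (hdelta : 0 < delta)
  (mu : R -> R) (hmuC1 : C1 mu)
  (hmu : gtrsim mu (fun t : R => t * ln t `^ (1 + delta)))
  (c1 c2 : R) (hc1 : 0 < c1) (hc12 : c1 < c2) :
  (fun t : R => H1norm (annulus c1 c2 (mu t)) (u t)
          + L2norm (annulus c1 c2 (mu t)) (ut t)
          + L2norm (annulus c1 c2 (mu t)) (n t)
          + L2norm (annulus c1 c2 (mu t)) (v t)) @ +oo --> (0 : R).
Proof.
have hsup1 t : 0 <= t -> H1norm setT (u t) <= 1.
  move=> t0; rewrite (le_trans _ heps1)// -lee_fin (le_trans _ hsup)//.
  by apply: ereal_sup_ubound; exists t.
have [E1 [Q [Q0 HQ]]] := annulus_le_exterior hsol hsup1.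
have [c c0 Hc] := gtrsim_superlinear hdelta hmu.
(* Half the inner radius of the annulus, as in [annulus_le_exterior]. *)
pose r t := c1 * mu t / 2.
have r_large : r t @[t --> +oo] --> (+oo : set_system R).
  apply/cvgryPge => A; near=> t.
  have [t1 l1 h] : [/\ 1 <= t, 1 <= ln t & c * (t * ln t) <= mu t] by near: t.
  have At : A * (2 / (c1 * c)) <= t.
    by near: t; apply: nbhs_pinfty_ge; exact: num_real.
  have cc : 0 < c1 * c by rewrite mulr_gt0.
  rewrite mulrA ler_pdivrMr// in At.
  have h2 : c * t <= mu t.
    by rewrite (le_trans _ h)// ler_pM2l// ler_peMr//; lra.
  have h3 : c1 * (c * t) <= c1 * mu t by rewrite ler_pM2l.
  by rewrite /r; lra.
have tr0 : t / r t @[t --> +oo] --> 0.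
  (* The lower bound c t ln t for [mu t] gives t / r = 2 t / (c1 mu(t)) <= 2 / (c1 c ln t). *)
  apply: (@squeeze_cvgr _ _ _ _ (fun=> 0) (fun t => 2 / (c1 * c) * (ln t)^-1)).
  - near=> t.
    have [t1 l1 h] : [/\ 1 <= t, 1 <= ln t & c * (t * ln t) <= mu t] by near: t.
    have l0 : 0 < ln t by lra.
    have t0 : 0 < t by lra.
    have p : 0 < c * (t * ln t) by rewrite !mulr_gt0.
    have m0 : 0 < mu t by rewrite (lt_le_trans p).
    have r0 : 0 < r t by rewrite divr_gt0// mulr_gt0.
    rewrite divr_ge0 ?(ltW t0) ?(ltW r0)//= ler_pdivrMr//.
    have -> : 2 / (c1 * c) / ln t * r t = t * (mu t / (c * (t * ln t))).
      by rewrite /r; field; rewrite !gt_eqF.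
    by rewrite ler_peMr ?(ltW t0)// ler_pdivlMr// mul1r.
  - exact: cvg_cst.
  - rewrite -[X in _ --> X](mulr0 (2 / (c1 * c))); apply: cvgM; first exact: cvg_cst.
    apply/gtr0_cvgV0; last exact: ln_cvg_pinfty.
    by near=> t; rewrite ln_gt0//; near: t; exact: nbhs_pinfty_gt.
apply: (@squeeze_cvgr _ _ _ _ (fun=> 0)
  (fun t => 5 * Num.sqrt (8 * (Q (r t) + E1 * (t / r t))))).
- near=> t.
  have [t1 l1 h] : [/\ 1 <= t, 1 <= ln t & c * (t * ln t) <= mu t] by near: t.
  have p : 0 < c * (t * ln t) by rewrite !mulr_gt0//; lra.
  rewrite HQ; [|by lra|by rewrite mulr_gt0// (lt_le_trans p)].
  by rewrite andbT !addr_ge0 ?sqrtr_ge0// L2normE nrm_ge0.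
- exact: cvg_cst.
- rewrite [X in _ --> X](_ : _ = 5 * Num.sqrt (8 * (0 + E1 * 0))); last first.
    by rewrite mulr0 addr0 mulr0 sqrtr0 mulr0.
  apply: cvgM; first exact: cvg_cst.
  apply: (@cvg_comp _ _ _ (fun t => 8 * (Q (r t) + E1 * (t / r t))) Num.sqrt); last exact: sqrt_continuous.
  apply: cvgM; first exact: cvg_cst.
  apply: cvgD; first exact: (cvg_comp _ _ r_large Q0).
  by apply: cvgM => //; exact: cvg_cst.
Unshelve. all: end_near. Qed.
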